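(* Let $\|\mathcal L_n\|$ and $\|\mathcal L_n^*\|$ denote the operator norms (with respect to the uniform norm) of $\mathcal L_n:C(\Delta)\to C(\Delta)$ and $\mathcal L_n^*:C(\Delta)\to C(\Delta)$, respectively. Then there is a constant $c$, independent of $n$, such that for all integers $n\ge2$ $$\|\mathcal L_n\|\le c(\log n)^2\qquad\text{and}\qquad\|\mathcal L_n^*\|\le c(\log n)^2 .$$ In particular, if $f\in C^1(\Delta)$, the class of functions having continuous derivatives on $\Delta$, then both $\mathcal L_nf$ and $\mathcal L_n^*f$ converge uniformly to $f$ on $\Delta$ (as $n\to\infty$).
   Context: $\mathbb R^3_H=\{\mathbf t\in\mathbb R^3:t_1+t_2+t_3=0\}$, $\mathbb H=\mathbb Z^3\cap\mathbb R^3_H$, $\phi_{\mathbf k}(\mathbf t)=e^{\frac{2\pi i}{3}\mathbf k\cdot\mathbf t}$ for $\mathbf k\in\mathbb H$. For functions on $\mathbb R_H^3$, $$\mathcal P^\pm f(t_1,t_2,t_3)=\tfrac16\big[f(t_1,t_2,t_3)+f(t_2,t_3,t_1)+f(t_3,t_1,t_2)\pm f(-t_1,-t_3,-t_2)\pm f(-t_2,-t_1,-t_3)\pm f(-t_3,-t_2,-t_1)\big],$$ $\mathsf{TC}_{\mathbf k}=\mathcal P^+\phi_{\mathbf k}$, $\mathsf{TS}_{\mathbf k}=\frac1i\mathcal P^-\phi_{\mathbf k}$. $\Delta=\{\mathbf t\in\mathbb R^3_H:0\le t_1,t_2,-t_3\le1\}$, identified with $\{(t_1,t_2):t_1,t_2\ge0,t_1+t_2\le1\}$.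 $\Lambda_n=\{\mathbf k\in\mathbb H:k_1\ge0,k_2\ge0,-k_3\le n\}$, $\Lambda_n^\circ=\{\mathbf k\in\mathbb H:k_1>0,k_2>0,-k_3<n\}$. $\mathcal{TC}_n=\mathrm{span}_{\mathbb C}\{\mathsf{TC}_{\mathbf k}:\mathbf k\in\Lambda_n\}$, $\mathcal{TS}_n=\mathrm{span}_{\mathbb C}\{\mathsf{TS}_{\mathbf k}:\mathbf k\in\Lambda_n^\circ\}$. For $f\in C(\Delta)$, $\mathcal L_n^*f$ is the unique function in $\mathcal{TC}_n$ with $\mathcal L_n^*f(\frac{\mathbf j}{n})=f(\frac{\mathbf j}{n})$ for all $\mathbf j\in\Lambda_n$, and $\mathcal L_nf$ is the unique function in $\mathcal{TS}_n$ with $\mathcal L_nf(\frac{\mathbf j}{n})=f(\frac{\mathbf j}{n})$ for all $\mathbf j\in\Lambda_n^\circ$.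
   Formalization: Uniform convergence of L_n f is stated only for f in C^1(Δ) vanishing on the boundary of Δ; this is necessary, since every function in TS_n is zero on the boundary (so the printed claim fails for f = 1). *)

(* Defs.v *)
From HB Require Import structures.
From mathcomp Require Import all_boot all_order all_algebra.
From mathcomp Require Import complex.
From mathcomp Require Import all_classical all_reals all_analysis.

Set Implicit Arguments.
Unset Strict Implicit.
Unset Printing Implicit Defensive.

Import Order.TTheory GRing.Theory Num.Theory.
Import numFieldNormedType.Exports.

Local Open Scope classical_set_scope.
Local Open Scope ring_scope.
Local Open Scope complex_scope.

(* Functions on the plane t1 + t2 + t3 = 0 are represented by functions of the
   triple (t1, t2, t3); below they are only compared, normed or differentiated
   along that plane, so the values off it are irrelevant. *)
Definition pt (R : realType) : Type := (R * R * R)%type.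

Definition freq : Type := (int * int * int)%type.

Definition inH : set freq := [set k | k.1.1 + k.1.2 + k.2 = 0].

Definition inR3H (R : realType) : set (pt R) :=
  [set t | t.1.1 + t.1.2 + t.2 = 0].

Definition cis (R : realType) (x : R) : R[i] := cos x +i* sin x.

Definition phi (R : realType) (k : freq) (t : pt R) : R[i] :=
  cis (2 * pi / 3
       * (k.1.1%:~R * t.1.1 + k.1.2%:~R * t.1.2 + k.2%:~R * t.2)).

(* The sign [s] is 1 for P^+ and -1 for P^-. *)
Definition symP (R : realType) (s : R[i]) (f : pt R -> R[i]) (t : pt R)
    : R[i] :=
  let: (t1, t2, t3) := t in
  6^-1 * (f (t1, t2, t3) + f (t2, t3, t1) + f (t3, t1, t2)
          + s * f (- t1, - t3, - t2) + s * f (- t2, - t1, - t3)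
          + s * f (- t3, - t2, - t1)).

Definition TC (R : realType) (k : freq) : pt R -> R[i] := symP 1 (phi k).

Definition TS (R : realType) (k : freq) : pt R -> R[i] :=
  fun t => 'i^-1 * symP (-1) (phi k) t.

Definition Delta (R : realType) : set (pt R) :=
  [set t | inR3H t /\
    [/\ 0 <= t.1.1 <= 1, 0 <= t.1.2 <= 1 & 0 <= - t.2 <= 1]].

(* Interior of Delta relative to the plane t1 + t2 + t3 = 0.  Every TS k
   vanishes on Delta outside Delta_int, hence so does every function of
   TSspace n: interpTS n f can converge uniformly on Delta to f only if f
   itself vanishes there. *)
Definition Delta_int (R : realType) : set (pt R) :=
  [set t | inR3H t /\ [/\ 0 < t.1.1, 0 < t.1.2 & - t.2 < 1]].

Definition Lambda (n : nat) : set freq :=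
  [set k | inH k /\ [/\ 0 <= k.1.1, 0 <= k.1.2 & - k.2 <= n%:Z]].

Definition Lambda_int (n : nat) : set freq :=
  [set k | inH k /\ [/\ 0 < k.1.1, 0 < k.1.2 & - k.2 < n%:Z]].

Definition cspan (R : realType) (A : set (pt R -> R[i])) : set (pt R -> R[i]) :=
  [set g | exists (m : nat) (c : 'I_m -> R[i]) (e : 'I_m -> pt R -> R[i]),
    (forall i, A (e i)) /\ g = (fun t => \sum_(i < m) c i * e i t)].

Definition TCspace (R : realType) (n : nat) : set (pt R -> R[i]) :=
  cspan [set TC (R:=R) k | k in Lambda n].

Definition TSspace (R : realType) (n : nat) : set (pt R -> R[i]) :=
  cspan [set TS (R:=R) k | k in Lambda_int n].

Definition node (R : realType) (n : nat) (j : freq) : pt R :=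
  (j.1.1%:~R / n%:R, j.1.2%:~R / n%:R, j.2%:~R / n%:R).

(* For n >= 1 exactly one function satisfies each of these two interpolation
   problems; [xget] selects it. *)
Definition interpTC (R : realType) (n : nat) (f : pt R -> R[i])
    : pt R -> R[i] :=
  xget (fun=> 0) [set g | TCspace n g /\
    forall j, Lambda n j -> g (node R n j) = f (node R n j)].

Definition interpTS (R : realType) (n : nat) (f : pt R -> R[i])
    : pt R -> R[i] :=
  xget (fun=> 0) [set g | TSspace n g /\
    forall j, Lambda_int n j -> g (node R n j) = f (node R n j)].

(* [R[i]^o] carries the topology of the complex modulus. *)
Definition CDelta (R : realType) : set (pt R -> R[i]) :=
  [set f | {within Delta (R:=R), continuous (f : pt R -> R[i]^o)}].

Definition unorm (R : realType) (f : pt R -> R[i]) : \bar R :=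
  ereal_sup [set (complex.Re `|f t|)%:E | t in Delta (R:=R)].

Definition opnorm (R : realType) (L : (pt R -> R[i]) -> pt R -> R[i])
    : \bar R :=
  ereal_sup [set unorm (L f) | f in [set f | CDelta f /\ (unorm f <= 1)%E]].

(* In the coordinates (t1, t2) the partial derivatives are the directional
   derivatives along (1, 0, -1) and (0, 1, -1).  As Delta is closed, they are
   required to exist in its interior and to extend continuously to Delta. *)
Definition rC1Delta (R : realType) (g : pt R -> R) : Prop :=
  {within Delta (R:=R), continuous g} /\
  forall v : pt R, v = (1, 0, -1) \/ v = (0, 1, -1) ->
    exists d : pt R -> R, {within Delta (R:=R), continuous d} /\
      forall t, Delta_int t -> is_derive t v g (d t).

Definition C1Delta (R : realType) : set (pt R -> R[i]) :=
  [set f | rC1Delta (fun t => complex.Re (f t)) /\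
           rC1Delta (fun t => complex.Im (f t))].

(* Main.v *)
Require Import Defs.
From HB Require Import structures.
From mathcomp Require Import all_boot all_order all_algebra.
From mathcomp Require Import complex.
From mathcomp Require Import all_classical all_reals all_analysis.
From mathcomp Require Import zify ring lra.

Set Implicit Arguments.
Unset Strict Implicit.
Unset Printing Implicit Defensive.

Import Order.TTheory GRing.Theory Num.Theory.
Import numFieldNormedType.Exports.

Local Open Scope classical_set_scope.
Local Open Scope ring_scope.
Local Open Scope complex_scope.

(** Both interpolation operators are treated at once, a boolean [b] selecting
    the cosine case ([false]) or the sine case ([true]).

    Interpolation.  The generalized cosines and sines are the averages of the
    exponentials phi_k over the group G of order six generated by the cyclic
    shifts and the negated transpositions, plain or with the sign character.
    Up to a constant, TC_k and TS_k evaluated at j/n do not change when k and j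
    are exchanged, so a single discrete orthogonality relation gives both that
    the Lagrange formula reproduces the space and that it interpolates
    ([orthogonality], [interpE]).  Orthogonality follows from the product
    formula [wave_product] and the quadrature rule [quadrature]: with weights
    6, 3, 1 at interior, edge and corner nodes, the sum over the triangle is the
    sum over a fundamental domain of the lattice of periods, because the affine
    reflections tile that domain by six triangles ([sum_fundamental_domain]).

    Lebesgue constant.  A Lagrange basis function is an average of 36 values of
    the kernel sum_k phi_k over the triangle of frequencies at points g t - h j/n
    ([lagrange_basis_kernel]).  Summing the double geometric series in two
    ways bounds this kernel by products of two one-variable quantities of the
    size of min(n, 1/distance to the integers) ([tri_bound]).  As j runs over
    the nodes, the two phases run injectively over a grid of mesh 1/(3n), so the
    double sum is at most the square of a one-dimensional sum of order n log n
    ([sum_damp_chord], [kernel_majorant_sum]); dividing by n^2 leaves (log n)^2.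

    Convergence.  By the projection property, the error is at most
    1 + c (log n)^2 times the error of any element of the space.  Such an element
    is the discrete convolution of f with a product of two Fejer kernels of
    length N about n/2, symmetrized over G ([quasi]).  The kernel is
    nonnegative with mean 1, its second moment is computed exactly by the
    quadrature rule, and since Delta is a fundamental domain of a reflection
    group, |t - s| is controlled by the distance of g t - h s to the periods
    ([geometry]); in the sine case an odd g h^-1 forces both points near the
    boundary, where f is small.  Hence the error for Lipschitz f is O(N^(-1/2))
    ([quasi_error]), which beats the squared logarithm.  A function with
    continuous first derivatives is Lipschitz on Delta: two interior points are
    joined by an axis-parallel path with one corner inside ([C1_lip]). *)

(** * The symmetry group and symmetrized exponentials *)

(** The six symmetries over which [symP] averages: 0, 1, 2 are the rotations
    and 3, 4, 5 the reflections, so [2 < i] says that the i-th one is odd.  The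
    same formulas act on points, on nodes and on frequencies. *)
Definition act (V : zmodType) (i : nat) (t : V * V * V) : V * V * V :=
  let: (a, b, c) := t in
  match i with
  | 0 => (a, b, c)
  | 1 => (b, c, a)
  | 2 => (c, a, b)
  | 3 => (- a, - c, - b)
  | 4 => (- b, - a, - c)
  | _ => (- c, - b, - a)
  end.

Definition inv_index (i : nat) : nat :=
  match i with 1 => 2 | 2 => 1 | _ => i end.

Lemma inv_index_lt (i : 'I_6) : (inv_index i < 6)%N.
Proof. by case: i => -[|[|[|[|[|[|]]]]]]. Qed.

Definition inv_ord (i : 'I_6) : 'I_6 := Ordinal (inv_index_lt i).

Lemma inv_ordK : involutive inv_ord.
Proof. by move=> i; apply/val_inj; case: i => -[|[|[|[|[|[|]]]]]]. Qed.

Section Char.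
Variable R : realType.
Implicit Types (x y : R) (t u : R * R * R) (k l m : int * int * int).
Local Notation C := R[i].

(** All phases are measured in full turns, which makes periodicity
    translation by integers. *)
Definition chi x : C := cis (2 * pi * x).

Lemma chiD x y : chi (x + y) = chi x * chi y.
Proof.
rewrite /chi /cis mulrDr cosD sinD.
apply/eqP; rewrite eq_complex /=; apply/andP; split; apply/eqP; ring.
Qed.

Lemma chi0 : chi 0 = 1.
Proof. by rewrite /chi /cis mulr0 cos0 sin0. Qed.

Lemma chiN x : chi (- x) * chi x = 1.
Proof. by rewrite -chiD addNr chi0. Qed.

Lemma chi1 : chi 1 = 1.
Proof. by rewrite /chi /cis mulr1 mulr_natl cos2pi sin2pi. Qed.

Lemma chi_nat n : chi n%:R = 1.
Proof.
elim: n => [|n IH]; first exact: chi0.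
by rewrite -natr1 chiD IH chi1 mulr1.
Qed.

Lemma chi_int (z : int) : chi z%:~R = 1.
Proof.
case: (intP z) => [|n|n]; first exact: chi0.
  by rewrite -[_.+1%:Z%:~R]/(n.+1%:R) chi_nat.
have := chiN (n.+1%:R).
by rewrite chi_nat mulr1 mulrNz.
Qed.

Lemma chi_conj x : (chi x)^*%C = chi (- x).
Proof. by rewrite /chi /cis mulrN cosN sinN. Qed.

Definition dot k t : R := k.1.1%:~R * t.1.1 + k.1.2%:~R * t.1.2 + k.2%:~R * t.2.

Lemma phiE k t : phi k t = chi (dot k t / 3).
Proof. by rewrite /phi /chi /dot; congr cis; rewrite -!mulrA; congr (_ * _); ring. Qed.

Lemma dotDr k t u : dot k (t + u) = dot k t + dot k u.
Proof. by rewrite /dot /=; ring. Qed.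
Lemma dotDl k l t : dot (k + l) t = dot k t + dot l t.
Proof. by rewrite /dot /= !rmorphD /=; ring. Qed.
Lemma dotNr k t : dot k (- t) = - dot k t.
Proof. by rewrite /dot /=; ring. Qed.
Lemma dotNl k t : dot (- k) t = - dot k t.
Proof. by rewrite /dot /= !rmorphN /=; ring. Qed.

Lemma phiDr k t u : phi k (t + u) = phi k t * phi k u.
Proof. by rewrite !phiE dotDr mulrDl chiD. Qed.
Lemma phiDl k l t : phi (k + l) t = phi k t * phi l t.
Proof. by rewrite !phiE dotDl mulrDl chiD. Qed.
Lemma phiN k t : phi (- k) t = phi k (- t).
Proof. by rewrite !phiE dotNl dotNr. Qed.
Lemma phi0 t : phi 0 t = 1.
Proof. by rewrite phiE /dot /= !mul0r !addr0 mul0r chi0. Qed.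

(** Each symmetry is orthogonal, so its adjoint is its inverse: moving a
    symmetry from the point to the frequency is what makes the two roles
    interchangeable below. *)
Lemma dot_act k t (i : 'I_6) : dot (act i k) t = dot k (act (inv_ord i) t).
Proof.
case: k => -[a b] c; case: t => -[x y] z.
case: i => -[|[|[|[|[|[|]]]]]] //= Hi; rewrite /dot /= ?rmorphN /=; ring.
Qed.

Lemma phi_act k t (i : 'I_6) : phi (act i k) t = phi k (act (inv_ord i) t).
Proof. by rewrite !phiE dot_act. Qed.

Lemma tripB (V : zmodType) (a b c x y z : V) :
  (a, b, c) - (x, y, z) = (a - x, b - y, c - z).
Proof. by []. Qed.

Lemma tripN (V : zmodType) (a b c : V) : - (a, b, c) = (- a, - b, - c).
Proof. by []. Qed.

Lemma actB (V : zmodType) (i : nat) (t u : V * V * V) :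
  act i (t - u) = act i t - act i u.
Proof.
case: t => -[a b] c; case: u => -[x y] z; rewrite tripB.
by case: i => [|[|[|[|[|i]]]]] /=; rewrite tripB // !opprB !opprK ![_ + - _]addrC.
Qed.


Definition sgn (b : bool) (i : nat) : C := if b && (2 < i)%N then -1 else 1.
Definition psign (b : bool) : C := if b then -1 else 1.

Lemma sgn_inv_ord b (i : 'I_6) : sgn b (inv_ord i) = sgn b i.
Proof. by case: i => -[|[|[|[|[|[|]]]]]]. Qed.

Lemma sgn_sq b i : sgn b i * sgn b i = 1.
Proof. by rewrite /sgn; case: ifP => _; rewrite ?mulrNN mulr1. Qed.

Definition symmetrize (V : zmodType) b (f : V * V * V -> C) (t : V * V * V) : C :=
  6^-1 * \sum_(i < 6) sgn b i * f (act i t).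

Lemma symPE b (f : R * R * R -> C) t : symP (psign b) f t = symmetrize b f t.
Proof.
case: t => -[x y] z; rewrite /symmetrize !big_ord_recl big_ord0 /= /symP /sgn /psign.
by case: b => /=; congr (_ * _); ring.
Qed.

Lemma symmetrize_act (V : zmodType) b (f : V * V * V -> C) (t : V * V * V) (i : 'I_6) :
  symmetrize b f (act i t) = sgn b i * symmetrize b f t.
Proof.
case: t => -[x y] z; rewrite /symmetrize mulrCA; congr (_ * _).
rewrite !big_ord_recl !big_ord0 /= /sgn.
by case: b; case: i => -[|[|[|[|[|[|]]]]]] //= _; rewrite ?opprK; ring.
Qed.

Lemma symmetrize_phi b k t : symmetrize b (phi k) t = symmetrize b (fun m => phi m t) k.
Proof.
rewrite /symmetrize (reindex_inj (inv_inj inv_ordK)) /=; congr (_ * _).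
by apply: eq_bigr => i _; rewrite sgn_inv_ord phi_act.
Qed.

(** TC_k for [b = false], and i TS_k for [b = true]; dropping the factor i
    changes neither the span nor the interpolation problem. *)
Definition wave b k t : C := symmetrize b (phi k) t.

Lemma wave_act b k t (i : 'I_6) : wave b k (act i t) = sgn b i * wave b k t.
Proof. exact: symmetrize_act. Qed.

Lemma wave_act_freq b k t (i : 'I_6) : wave b (act i k) t = sgn b i * wave b k t.
Proof. by rewrite /wave !symmetrize_phi symmetrize_act. Qed.

(** Averaging one factor over the group moves the symmetries onto the other
    factor, which is invariant up to sign.  With [-l] in place of [l] the second
    factor is a complex conjugate, so this linearizes the products met in
    orthogonality relations without mentioning conjugation. *)
Lemma wave_product b k l t :
  wave b k t * wave b l t = 6^-1 * \sum_(i < 6) sgn b i * wave false (act i k + l) t.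
Proof.
rewrite {2}/wave /symmetrize mulrCA; congr (_ * _); rewrite mulr_sumr.
rewrite (eq_bigr (fun i : 'I_6 => wave b k (act i t) * phi l (act i t))); last first.
  by move=> i _; rewrite wave_act mulrA [_ * sgn _ _]mulrC.
rewrite (eq_bigr (fun i : 'I_6 => \sum_(j < 6) 6^-1 * (sgn b j * phi (act j k + l) (act i t)))); last first.
  move=> i _; rewrite /wave symmetrize_phi /symmetrize -mulrA mulr_suml mulr_sumr.
  by apply: eq_bigr => j _; rewrite phiDl !mulrA.
rewrite exchange_big /=; apply: eq_bigr => j _.
rewrite /wave /symmetrize mulrCA mulr_sumr mulr_sumr; apply: eq_bigr => i _.
by rewrite /sgn andFb mul1r mulrCA.
Qed.

(** The reproducing kernels become averages of translates of unsymmetrized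
    kernels. *)
Lemma wave_two_point b k t u :
  wave b k t * wave b (- k) u = 36^-1 * \sum_(i < 6) \sum_(j < 6)
    sgn b i * sgn b j * phi k (act i t - act j u).
Proof.
rewrite /wave /symmetrize mulrACA -invfM -natrM; congr (_ * _).
rewrite mulr_suml; apply: eq_bigr => i _; rewrite mulr_sumr; apply: eq_bigr => j _.
by rewrite phiDr phiN mulrACA.
Qed.
End Char.

(** * Folding a fundamental domain of the periods onto the triangle *)

Definition tri_cond (n e1 e2 e3 x y : nat) : bool :=
  [&& e1 <= x, e2 <= y & x + y + e3 <= n]%N.

(** Interior, edge and corner points of the triangle get 6, 3 and 1 in the
    cosine case (the orbit sizes modulo the periods), interior points get 6 and
    all others 0 in the sine case.  In the cosine case this is written as a sum of
    six indicators of shifted triangles, so that weighted kernels reduce to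
    unweighted sums over triangles. *)
Definition wt (b : bool) (n x y : nat) : nat :=
  if b then (6 * tri_cond n 1 1 1 x y)%N else
  (tri_cond n 1 0 0 x y + tri_cond n 0 1 0 x y + tri_cond n 0 0 1 x y
   + tri_cond n 1 1 0 x y + tri_cond n 1 0 1 x y + tri_cond n 0 1 1 x y)%N.

Section Tile.
Variable V : comNzRingType.

Definition simplex_sum n (h : nat -> nat -> nat -> V) : V :=
  \sum_(x < n.+1) \sum_(y < n.+1 | (x + y <= n)%N) h x y (n - x - y)%N.

Lemma simplex_sum3 n h : simplex_sum n h =
  \sum_(x < n.+1) \sum_(y < n.+1) \sum_(z < n.+1 | (x + y + z == n)%N) h x y z.
Proof.
apply: eq_bigr => x _; rewrite big_mkcond /=; apply: eq_bigr => y _.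
case: ifP => xy.
  have hz : (n - x - y < n.+1)%N by lia.
  rewrite (big_pred1 (Ordinal hz)) // => z.
  by apply/eqP/eqP => [?|->/=]; [apply/val_inj => /=; lia | lia].
by rewrite big_pred0 // => z; apply/negP => /eqP; lia.
Qed.

(** The two free coordinates hide that the triangle x + y + z = n has a
    symmetry of order three; this lemma restores it. *)
Lemma simplex_sum_rot n h : simplex_sum n h = simplex_sum n (fun x y z => h y z x).
Proof.
rewrite !simplex_sum3 [RHS]exchange_big /=; apply: eq_bigr => x _.
under [RHS]eq_bigr do rewrite big_mkcond.
rewrite [RHS]exchange_big /=; apply: eq_bigr => y _.
rewrite big_mkcond /=; apply: eq_bigr => z _.
by congr (if _ then _ else _); congr (_ == _); lia.
Qed.

Lemma simplex_sum_add n h1 h2 :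
  simplex_sum n (fun x y z => h1 x y z + h2 x y z) = simplex_sum n h1 + simplex_sum n h2.
Proof.
by rewrite /simplex_sum -big_split; apply: eq_bigr => x _; rewrite -big_split.
Qed.

Lemma eq_simplex_sum n h1 h2 :
  (forall x y z, (x + y + z = n)%N -> h1 x y z = h2 x y z) -> simplex_sum n h1 = simplex_sum n h2.
Proof.
move=> h12; rewrite /simplex_sum; apply: eq_bigr => x _; apply: eq_bigr => y xy.
by apply: h12; lia.
Qed.

(** The box 0 <= a < n, 0 <= b < 3n is a fundamental domain of the lattice of
    periods generated by (n, n) and (0, 3n).  The lines a + b = multiple of n and
    b = multiple of n cut it into six triangles, each the image of the basic one
    under an affine symmetry.  Upright triangles contain two edges and one corner,
    inverted ones a single edge; averaging over the rotation of the basic triangle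
    turns these half-open contributions into the weights 6, 3, 1. *)
Lemma sum_fundamental_domain n (F : int -> int -> V) :
  (forall a b, F a b = F b (- a - b)) ->
  (forall a b, F a b = F (- b) (- a)) ->
  (forall a b, F (a + n%:Z) (b + n%:Z) = F a b) ->
  (forall a b, F a (b + 3 * n%:Z) = F a b) ->
  \sum_(a < n) \sum_(b < n + n + n) F a b =
  \sum_(x < n.+1) \sum_(y < n.+1) (wt false n x y)%:R * F x y.
Proof.
move=> Frot Fref Fper1 Fper2.
have H1 a b : F a (b + n%:Z) = F b (n%:Z - a - b).
  rewrite Frot -(Fper1 b) -(Fper2 (b + _)); congr F; lia.
have H2 a b : F a (b + n%:Z + n%:Z) = F (n%:Z - a - b) a.
  rewrite (Frot (n%:Z - a - b)) -(Fper1 a) -(Fper2 (a + n%:Z)).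
  have -> : - (n%:Z - a - b) - a = b - n%:Z by lia.
  rewrite -[RHS](Fper2 a) -[RHS]Fper1 -(Fper2 (a + n%:Z) (b - _ + _ + _)).
  by congr F; lia.
have H3 a b : F a b = F (n%:Z - b) (n%:Z - a).
  by rewrite Fref -Fper1; congr F; lia.
pose G (x y z : nat) := F x y + F y z + F z x.
(* The inverted triangle a + b >= n, reflected in the side a + b = n. *)
have HT2 : \sum_(x < n.+1) \sum_(y < n.+1 | (x + y <= n)%N)
    ((0 < x)%N && (0 < y)%N)%:R * G x y (n - x - y)%N =
  \sum_(a < n.+1) \sum_(b < n.+1)
   (if [&& a < n, b < n & n <= a + b]%N then G (n - b)%N (n - a)%N (a + b - n)%N else 0).
  rewrite (exchange_big_dep xpredT) //= (reindex_inj rev_ord_inj) /=; apply: eq_bigr => a _.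
  rewrite (reindex_inj rev_ord_inj) big_mkcond /=; apply: eq_bigr => b _.
  rewrite !subSS.
  have := ltn_ord a; have := ltn_ord b => ? ?.
  have -> : (n - (n - b) - (n - a) = a + b - n)%N by lia.
  case: ifP => h1; case: ifP => h2 //.
  - have -> : (0 < n - b)%N && (0 < n - a)%N by lia.
    by rewrite mul1r.
  - have -> : (0 < n - b)%N && (0 < n - a)%N = false by apply/negP; lia.
    by rewrite mul0r.
  - lia.
(* The upright triangle a + b < n, whose side z = 0 is left out. *)
have HT1 : \sum_(x < n.+1) \sum_(y < n.+1 | (x + y <= n)%N)
    ((0 < n - x - y)%N)%:R * G x y (n - x - y)%N =
  \sum_(a < n.+1) \sum_(b < n.+1)
   (if [&& a < n, b < n & a + b < n]%N then G a b (n - a - b)%N else 0).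
  apply: eq_bigr => a _; rewrite big_mkcond /=; apply: eq_bigr => b _.
  case: ifP => h1; case: ifP => h2 //.
  - have -> : (0 < n - a - b)%N by lia.
    by rewrite mul1r.
  - have -> : (0 < n - a - b)%N = false by apply/negP; lia.
    by rewrite mul0r.
  - lia.
have -> : \sum_(a < n) \sum_(b < n + n + n) F a b =
  simplex_sum n (fun x y z => ((0 < z)%N%:R + ((0 < x)%N && (0 < y)%N)%:R) * G x y z).
  under [in RHS]eq_simplex_sum => x y z _ do rewrite mulrDl.
  rewrite simplex_sum_add {1 2}/simplex_sum HT1 HT2 -big_split big_ord_recr /= [X in _ = _ + X](_ : _ = 0) ?addr0; last first.
    by rewrite -big_split big1 //= => b _; rewrite ltnn /= addr0.
  apply: eq_bigr => a _; rewrite -big_split big_ord_recr /= ltnn !andbF /= !addr0.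
  rewrite !big_split_ord /= -!big_split; apply: eq_bigr => b _ /=.
  have := ltn_ord a; have := ltn_ord b => ? ?.
  have -> : (n + b)%N%:Z = b%:Z + n%:Z by lia.
  have -> : (n + n + b)%N%:Z = b%:Z + n%:Z + n%:Z by lia.
  case: (leqP n (a + b)) => ab.
    have -> : [&& (a < n)%N, (b < n)%N & true] by lia.
    rewrite !andbF add0r /G H1 H2 (H3 a b).
    have -> : (a + b - n)%N%:Z = a%:Z + b%:Z - n%:Z by lia.
    have -> : (n - b)%N%:Z = n%:Z - b%:Z by lia.
    have -> : (n - a)%N%:Z = n%:Z - a%:Z by lia.
    congr (_ + _ + _).
      by rewrite Fref Frot Frot; congr F; lia.
    by rewrite Fref Frot; congr F; lia.
  have -> : [&& (a < n)%N, (b < n)%N & true] by lia.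
  rewrite !andbF addr0 /G H1 H2.
  by have -> : (n - a - b)%N%:Z = n%:Z - a%:Z - b%:Z by lia.
rewrite /G.
pose f (x y z : nat) := F x y.
pose v x y z : V := (0 < z)%N%:R + ((0 < x)%N && (0 < y)%N)%:R.
(* Rotating each summand so that F is always evaluated at (x, y) leaves the
   rotation-invariant weight v x y z + v z x y + v y z x, which is [wt]. *)
transitivity (simplex_sum n (fun x y z => v x y z * f x y z + v z x y * f x y z + v y z x * f x y z)).
  rewrite !simplex_sum_add [X in _ + X + _]simplex_sum_rot [X in _ = _ + X]simplex_sum_rot [X in _ = _ + X]simplex_sum_rot -!simplex_sum_add.
  by apply: eq_simplex_sum => x y z _; rewrite /v /f; ring.
rewrite /simplex_sum; apply: eq_bigr => x _; rewrite big_mkcond /=; apply: eq_bigr => y _.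
rewrite /wt /tri_cond /v /f.
case: (leqP (x + y) n) => xy; last first.
  have -> : (x + y + 0 <= n)%N = false by apply/negP; lia.
  have -> : (x + y + 1 <= n)%N = false by apply/negP; lia.
  by rewrite !andbF !mul0r.
have -> : (x + y + 0 <= n)%N by lia.
have -> : (x + y + 1 <= n)%N = (0 < n - x - y)%N by lia.
rewrite !natrD -!mulrDl; congr (_ * _).
by case: (0 < x)%N; case: (0 < y)%N; case: (0 < n - x - y)%N; rewrite /=; ring.
Qed.
End Tile.

(** * Modulus, and the distance of a phase to the integers *)

Section Modulus.
Variable R : realType.
Local Notation C := R[i].
Implicit Types (z w : C) (x : R).

(** The modulus as a real number, in the form in which [unorm] uses it. *)
Definition cmod z : R := complex.Re `|z|.

Lemma cmodE z : `|z| = (cmod z)%:C.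
Proof. by rewrite /cmod normc_def. Qed.
Lemma cmod_ge0 z : 0 <= cmod z.
Proof. by rewrite -ler0c -cmodE. Qed.
Lemma cmod0 : cmod 0 = 0.
Proof. by apply: complexI; rewrite -cmodE normr0. Qed.
Lemma cmod1 : cmod 1 = 1.
Proof. by apply: complexI; rewrite -cmodE normr1. Qed.
Lemma cmodN z : cmod (- z) = cmod z.
Proof. by apply: complexI; rewrite -!cmodE normrN. Qed.
Lemma cmodM z w : cmod (z * w) = cmod z * cmod w.
Proof. by apply: complexI; rewrite rmorphM /= -!cmodE normrM. Qed.
Lemma cmodX z n : cmod (z ^+ n) = cmod z ^+ n.
Proof. by elim: n => [|n IH]; rewrite ?expr0 ?cmod1 // !exprS cmodM IH. Qed.
Lemma cmod_add z w : cmod (z + w) <= cmod z + cmod w.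
Proof. by rewrite -lecR rmorphD /= -!cmodE ler_normD. Qed.
Lemma cmod_sub z w : cmod (z - w) <= cmod z + cmod w.
Proof. by apply: le_trans (cmod_add _ _) _; rewrite cmodN. Qed.
Lemma cmod_sum (I : Type) (r : seq I) (P : pred I) (F : I -> C) :
  cmod (\sum_(i <- r | P i) F i) <= \sum_(i <- r | P i) cmod (F i).
Proof.
elim/big_rec2: _ => [|i x z _ IH]; first by rewrite cmod0.
by apply: le_trans (cmod_add _ _) _; rewrite lerD2l.
Qed.
Lemma cmod_real x : cmod x%:C = `|x|.
Proof. by rewrite /cmod normc_def /= expr0n addr0 sqrtr_sqr. Qed.
Lemma cmod_nat n : cmod n%:R = n%:R.
Proof. by rewrite -(rmorph_nat (real_complex R)) cmod_real normr_nat. Qed.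
Lemma cmodV z : cmod z^-1 = (cmod z)^-1.
Proof. by apply: complexI; rewrite fmorphV /= -!cmodE normfV. Qed.

Lemma cmod_sqr z : ((cmod z) ^+ 2)%:C = z * z^*%C.
Proof. by rewrite -sqr_normc cmodE rmorphXn. Qed.

Lemma cmod_chi x : cmod (chi x) = 1.
Proof. by rewrite /cmod normc_def /= cos2Dsin2 sqrtr1. Qed.


Lemma cmod_sgn b i : cmod (sgn R b i) = 1.
Proof. by rewrite /sgn; case: ifP; rewrite ?cmodN cmod1. Qed.

Lemma chiX x n : chi (x * n%:R) = chi x ^+ n.
Proof.
elim: n => [|n IH]; first by rewrite mulr0 chi0.
by rewrite -natr1 mulrDr mulr1 chiD IH exprSr.
Qed.

(** A weak form of Jordan's inequality: halve the angle, so that both cosines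
    produced by the mean value theorem and the duplication formula are at least
    cos (pi / 4), whose square is 1/2. *)
Lemma sin_lower x : 0 <= x <= pi / 2 -> x / 2 <= sin x.
Proof.
move=> /andP[x0 x1]; have pi0 := pi_gt0 R.
pose y := x / 2; have -> : x = y *+ 2 by rewrite /y -mulr_natr; field.
have y0 : 0 <= y by rewrite /y; lra.
have y1 : y <= pi / 4 by rewrite /y; lra.
have [|c] := @MVT_segment R sin cos 0 y y0.
  by apply: continuous_subspaceT => z; exact: continuous_sin.
rewrite in_itv /= sin0 !subr0 => /andP[c0 c1] hsin.
rewrite sin_mulr2n hsin.
have cc (u : R) : 0 <= u <= y -> cos (pi / 4) <= cos u.
  move=> /andP[z0 z1]; case: (ltgtP u (pi / 4)) => [h|h|->//].
    by apply/ltW; rewrite ltr_cos // in_itv /=; apply/andP; split; lra.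
  lra.
have h4 : cos (pi / 4 : R) ^+ 2 = 1 / 2.
  have := cos_mulr2n (pi / 4 : R).
  have -> : (pi / 4 : R) *+ 2 = pi / 2 by rewrite -mulr_natr; field.
  by rewrite cos_pihalf -mulr_natr; lra.
have p4 : 0 <= cos (pi / 4 : R) by apply: cos_ge0_pihalf; apply/andP; split; lra.
have hc := cc c; have hy := cc y; rewrite c0 c1 y0 lexx in hc hy.
have := hc isT; have := hy isT => {hc hy} hy hc.
have : 1 / 2 <= cos c * cos y by rewrite -h4 expr2 ler_pM.
rewrite !mulr2n => h.
have : y * (1 / 2) <= y * (cos c * cos y) by rewrite ler_wpM2l.
nra.
Qed.

Lemma cmod_1chi x : cmod (1 - chi x) = 2 * `|sin (pi * x)|.
Proof.
have h : (cmod (1 - chi x)) ^+ 2 = (2 * `|sin (pi * x)|) ^+ 2.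
  rewrite /cmod normc_def /= sqr_sqrtr ?addr_ge0 ?sqr_ge0 // exprMn real_normK ?num_real //.
  have -> : 2 * pi * x = (pi * x) *+ 2 by rewrite -mulr_natr; ring.
  rewrite cos_mulr2n sin_mulr2n sub0r !mulr2n.
  have := cos2Dsin2 (pi * x); set c := cos _; set s := sin _ => h.
  have -> : 1 - (c ^+ 2 + c ^+ 2 - 1) = s ^+ 2 + s ^+ 2 by lra.
  transitivity (4 * s ^+ 2 * (c ^+ 2 + s ^+ 2)); first by ring.
  by rewrite h; ring.
by apply/eqP; rewrite -(eqrXn2 (n:=2)) ?h ?cmod_ge0 // mulr_ge0.
Qed.

Lemma cmod_1chi_lower x : `|x| <= 1 / 2 -> 2 * `|x| <= cmod (1 - chi x).
Proof.
move=> hx; rewrite cmod_1chi.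
have -> : `|sin (pi * x)| = `|sin (pi * `|x|)|.
  by case: (ger0P x) => // _; rewrite mulrN sinN normrN.
have p2 := pi_ge2 R; have := normr_ge0 x => x0.
have h : pi * `|x| / 2 <= sin (pi * `|x|).
  apply: sin_lower; apply/andP; split; first by rewrite mulr_ge0 // pi_ge0.
  by nra.
have := ler_norm (sin (pi * `|x|)); nra.
Qed.

(** The chord 1 - chi x dominates the distance of x to the integers; the
    bound is used both for orthogonality of characters and for the decay of
    kernels. *)
Lemma chi_near x : exists p : int, `|x - p%:~R| <= cmod (1 - chi x) /\ `|x - p%:~R| <= 1 / 2.
Proof.
pose p := Num.floor (x + 1 / 2).
have /andP[h1 h2] := floor_itv (x + 1 / 2).
have hp : `|x - p%:~R| <= 1 / 2.
  move: h1 h2; rewrite -/p intrD => h1 h2; rewrite ler_norml; lra.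
exists p; split => //.
have -> : chi x = chi (x - p%:~R).
  by rewrite chiD -rmorphN chi_int mulr1.
have := cmod_1chi_lower hp; have := normr_ge0 (x - p%:~R); lra.
Qed.

Lemma chi_eq1 x : chi x = 1 -> exists p : int, x = p%:~R.
Proof.
move=> h; have [p [hp _]] := chi_near x; exists p.
by move: hp; rewrite h subrr cmod0 normr_le0 subr_eq0 => /eqP.
Qed.

Lemma geom_int (q : int) (M : nat) : (0 < M)%N ->
  \sum_(b < M) chi (q%:~R / M%:R : R) ^+ b = if (M%:Z %| q)%Z then M%:R else 0.
Proof.
move=> M0; have M0' : M%:R != 0 :> R by rewrite pnatr_eq0 -lt0n.
case: ifP => h.
  case/dvdzP: h => d ->.
  rewrite rmorphM /= -[M%:~R]/(M%:R) mulfK // chi_int.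
  by under eq_bigr do rewrite expr1n; rewrite sumr_const card_ord.
set z := chi _.
have zM : z ^+ M = 1 by rewrite -chiX divfK // chi_int.
have := subrX1 z M; rewrite zM subrr => /esym/eqP; rewrite mulf_eq0 => /orP[|/eqP//].
rewrite subr_eq0 => /eqP /chi_eq1 [p hp].
have hq : q%:~R = (p * M%:Z)%:~R :> R by rewrite rmorphM /= -hp divfK.
move/eqP: hq; rewrite eqr_int => /eqP hq; move: h.
by rewrite hq dvdz_mull.
Qed.
End Modulus.

(** * Quadrature and discrete orthogonality *)

Definition tfreq (x y : nat) : int * int * int := (x%:Z, y%:Z, - (x%:Z + y%:Z)).

(** The frequencies k with phi_k = 1 at all points j/n: the multiples by n of
    the triples of integers congruent to each other modulo 3. *)
Definition aliases0 (n : nat) (k : int * int * int) : bool :=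
  ((3 * n)%N%:Z %| k.1.1 - k.2)%Z && ((3 * n)%N%:Z %| k.1.2 - k.2)%Z.

Lemma aliases0P n (k : int * int * int) :
  reflect (exists d e : int, k.1.1 - k.2 = d * (3 * n)%N%:Z /\ k.1.2 - k.2 = e * (3 * n)%N%:Z)
    (aliases0 n k).
Proof.
apply: (iffP andP) => [[/dvdzP[d hd] /dvdzP[e he]]|[d [e [hd he]]]].
  by exists d, e.
by split; apply/dvdzP; [exists d | exists e].
Qed.

Lemma aliases0_act_imp n k (i : nat) : aliases0 n k -> aliases0 n (act i k).
Proof.
case: k => -[a b] c /aliases0P[d [e /= [hd he]]]; apply/aliases0P.
case: i => [|[|[|[|[|i]]]]] /=.
- by exists d, e.
- by exists (e - d), (- d); split; lia.
- by exists (- e), (d - e); split; lia.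
- by exists (e - d), e; split; lia.
- by exists (- e), (- d); split; lia.
- by exists d, (d - e); split; lia.
Qed.

Lemma actVK (V : zmodType) (i : 'I_6) (t : V * V * V) : act (inv_ord i) (act i t) = t.
Proof.
by case: t => -[a b] c; case: i => -[|[|[|[|[|[|]]]]]] //= _; rewrite !opprK.
Qed.

Lemma aliases0_act n k (i : 'I_6) : aliases0 n (act i k) = aliases0 n k.
Proof.
apply/idP/idP; last exact: aliases0_act_imp.
by move/(aliases0_act_imp (inv_ord i)); rewrite actVK.
Qed.

Lemma inH_act k (i : nat) : inH k -> inH (act i k).
Proof.
case: k => -[a b] c; rewrite /inH /= => h.
by case: i => [|[|[|[|[|i]]]]] /=; lia.
Qed.

Lemma inH_tfreq x y : inH (tfreq x y).
Proof. by rewrite /inH /tfreq /=; lia. Qed.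

Lemma inH_sub k l : inH k -> inH l -> inH (k - l : int * int * int).
Proof. by case: k => -[a b] c; case: l => -[x y] z; rewrite /inH /=; lia. Qed.

Section Quad.
Variable R : realType.
Local Notation C := R[i].

Definition inode n (a b : int) : R * R * R := node R n (a, b, - (a + b)).
Definition tnode n (x y : nat) : R * R * R := node R n (tfreq x y).

Lemma act_node n j (i : nat) : act i (node R n j) = node R n (act i j).
Proof.
case: j => -[a b] c; rewrite /node.
by case: i => [|[|[|[|[|i]]]]] //=; rewrite !rmorphN /= !mulNr.
Qed.

Lemma eq_node n (a b c a' b' c' : int) : a = a' -> b = b' -> c = c' ->
  node R n (a, b, c) = node R n (a', b', c').
Proof. by move=> -> -> ->. Qed.

Lemma phi_inode n k a b : (0 < n)%N -> phi k (inode n a b) =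
  chi ((((k.1.1 - k.2) * a + (k.1.2 - k.2) * b)%:~R : R) / (3 * n)%:R).
Proof.
move=> n0; case: k => -[k1 k2] k3 /=.
rewrite phiE /dot /inode /node /= natrM.
have n0' : n%:R != 0 :> R by rewrite pnatr_eq0 -lt0n.
by congr chi; rewrite !rmorphD !rmorphM !rmorphN !rmorphD /=; field.
Qed.

(** Two geometric sums: the inner one has the full length 3n, and when it does
    not vanish the condition k in H makes the outer ratio an n-th root of unity, so
    that its length n suffices. *)
Lemma phi_inode_sum n k : (0 < n)%N -> inH k ->
  \sum_(a < n) \sum_(b < n + n + n) phi k (inode n a b) =
  if aliases0 n k then (3 * n ^ 2)%:R else 0 :> C.
Proof.
move=> n0 hk.
pose p := k.1.1 - k.2; pose q := k.1.2 - k.2.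
have N0 : (0 < 3 * n)%N by rewrite muln_gt0.
have E (a b : nat) : phi k (inode n a b) =
    chi (p%:~R / (3 * n)%:R : R) ^+ a * chi (q%:~R / (3 * n)%:R : R) ^+ b.
  rewrite phi_inode // -/p -/q -!chiX -chiD; congr chi.
  rewrite rmorphD !rmorphM /= -[a%:~R]/(a%:R) -[b%:~R]/(b%:R).
  have : n%:R != 0 :> R by rewrite pnatr_eq0 -lt0n.
  by rewrite natrM => ?; field.
have -> : (n + n + n = 3 * n)%N by lia.
under eq_bigr => a _ do under eq_bigr => b _ do rewrite E.
under eq_bigr => a _ do rewrite -mulr_sumr geom_int //.
rewrite -mulr_suml /aliases0 -/p -/q.
case: ifP => [hq|_]; last by rewrite mulr0 andbF.
rewrite andbT.
have [p' hp] : exists p', p = 3 * p'.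
  case/dvdzP: hq => d hd; exists (k.1.1 + k.1.2 - d * n%:Z).
  by move: hk hd; rewrite /inH /p /q /=; lia.
have -> : p%:~R / (3 * n)%:R = p'%:~R / n%:R :> R.
  rewrite hp rmorphM /= natrM.
  have : n%:R != 0 :> R by rewrite pnatr_eq0 -lt0n.
  by move=> ?; field.
rewrite geom_int //.
have -> : ((3 * n)%N%:Z %| p)%Z = (n%:Z %| p')%Z.
  by rewrite hp PoszM dvdz_mul2l.
case: ifP => _; last by rewrite mul0r.
by rewrite -natrM; congr (_%:R); lia.
Qed.

Lemma wave_sum_freq b k (t : R * R * R) : wave b k t = 6^-1 * \sum_(i < 6) sgn R b i * phi (act i k) t.
Proof. exact: symmetrize_phi. Qed.

(** The periods are integral combinations of (n, n, -2n) and (0, 3n, -3n). *)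
Lemma wave_periodic n k a b c d : (0 < n)%N -> inH k ->
  (exists u v : int, c = u * n%:Z /\ d = u * n%:Z + 3 * v * n%:Z) ->
  wave false k (inode n (a + c) (b + d)) = wave false k (inode n a b).
Proof.
move=> n0 hk [u [v [-> ->]]]; rewrite !wave_sum_freq; congr (_ * _).
apply: eq_bigr => i _; congr (_ * _); rewrite !phi_inode //.
have := inH_act i hk; move: (act i k) => [[k1 k2] k3] {hk} /= hk.
rewrite /inH /= in hk.
have -> : ((k1 - k3) * (a + u * n%:Z) + (k2 - k3) * (b + (u * n%:Z + 3 * v * n%:Z)))%:~R / (3 * n)%:R
  = ((k1 - k3) * a + (k2 - k3) * b)%:~R / (3 * n)%:R + ((k1 + k2) * u + (k2 - k3) * v)%:~R :> R.
  have -> : k3 = - (k1 + k2) by lia.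
  have : n%:R != 0 :> R by rewrite pnatr_eq0 -lt0n.
  rewrite natrM !rmorphD !rmorphM !rmorphD !rmorphN /= !rmorphD !rmorphM /= !rmorphD -[n%:~R]/(n%:R) => ?.
  by field.
by rewrite chiD chi_int mulr1.
Qed.

(** The rule sums a symmetrized exponential exactly over the group of nodes
    modulo periods, hence detects whether the frequency aliases to 0. *)
Lemma quadrature n k : (0 < n)%N -> inH k ->
  \sum_(x < n.+1) \sum_(y < n.+1) (wt false n x y)%:R * wave false k (tnode n x y) =
  if aliases0 n k then (3 * n ^ 2)%:R else 0.
Proof.
move=> n0 hk; rewrite -(@sum_fundamental_domain C n (fun a b => wave false k (inode n a b))).
- under eq_bigr => a _ do under eq_bigr => b _ do rewrite wave_sum_freq mulr_sumr.
  under eq_bigr => a _ do rewrite exchange_big /=.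
  rewrite exchange_big /=.
  rewrite (eq_bigr (fun=> 6^-1 * (if aliases0 n k then (3 * n ^ 2)%:R else 0))).
    by rewrite sumr_const card_ord -mulrnAl -(mulr_natr 6^-1) mulVf ?mul1r // pnatr_eq0.
  move=> i _; rewrite -(aliases0_act n k i) -phi_inode_sum //; last exact: inH_act.
  rewrite mulr_sumr; apply: eq_bigr => a _; rewrite mulr_sumr; apply: eq_bigr => b _.
  by rewrite /sgn andFb mul1r.
- move=> a b; have := wave_act false k (inode n a b) (@Ordinal 6 1 isT).
  rewrite /inode act_node /sgn andFb mul1r /= => <-.
  by apply: (f_equal (wave false k)); apply: eq_node; lia.
- move=> a b; have := wave_act false k (inode n a b) (@Ordinal 6 4 isT).
  rewrite /inode act_node /sgn andFb mul1r /= => <-.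
  by apply: (f_equal (wave false k)); apply: eq_node; lia.
- by move=> a b; apply: wave_periodic => //; exists 1, 0; lia.
- move=> a b; have := @wave_periodic n k a b 0 (3 * n%:Z) n0 hk; rewrite addr0; apply.
  by exists 0, 1; lia.
Qed.

(** The symmetries that fix the point (x, y) of the triangle modulo the
    n-fold periods: a reflection fixes one side and the opposite corner, a rotation
    only the corners. *)
Definition stab n (i x y : nat) : bool :=
  match i with
  | 0 => true
  | 1 | 2 => [|| (x == 0) && (y == 0), (x == n) && (y == 0) | (x == 0) && (y == n)]
  | 3 => (x == 0) || ((x == n) && (y == 0))
  | 4 => (x + y == n) || ((x == 0) && (y == 0))
  | _ => (y == 0) || ((x == 0) && (y == n))
  end%N.

(** The triangle is a strict fundamental domain of the affine reflection group:
    two of its points in the same orbit coincide. *)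
Lemma aliases0_tfreq n (i x y x' y' : nat) : (0 < n)%N -> (i < 6)%N ->
  (x + y <= n)%N -> (x' + y' <= n)%N ->
  aliases0 n (act i (tfreq x y) - tfreq x' y' : int * int * int)
  = [&& x == x', y == y' & stab n i x y].
Proof.
move=> n0 i6 h h'.
have bnd (P d m : int) : 0 < m -> P = d * m -> - m - m < P < m + m -> [\/ d = -1, d = 0 | d = 1].
  move=> m0 -> /andP[h1 h2].
  have : -2 < d by nia.
  have : d < 2 by nia.
  move=> ? ?; have : [|| d == -1, d == 0 | d == 1] by lia.
  by case/or3P => /eqP ->; [apply: Or31|apply: Or32|apply: Or33].
have m0 : 0 < (3 * n)%N%:Z by lia.
apply/aliases0P/idP => [[d [e []]]|/and3P[/eqP<- /eqP<-]].
  move=> h1 h2.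
  have hd : [\/ d = -1, d = 0 | d = 1].
    by apply: (bnd _ _ _ m0 h1); clear h2; move: i6 h1 => _ _; case: i => [|[|[|[|[|i]]]]] /=; lia.
  have he : [\/ e = -1, e = 0 | e = 1].
    by apply: (bnd _ _ _ m0 h2); clear h1; move: i6 h2 => _ _; case: i => [|[|[|[|[|i]]]]] /=; lia.
  by move: i6 h1 h2; case: hd => ->; case: he => ->; case: i => [|[|[|[|[|i]]]]] /= ? ? ?; lia.
case: i i6 => [|[|[|[|[|i]]]]] /= _ hs.
- by exists 0, 0; lia.
- by case/or3P: hs => hs; [exists 0, 0|exists (-1), (-1)|exists 0, (-1)]; lia.
- by case/or3P: hs => hs; [exists 0, 0|exists (-1), 0|exists (-1), (-1)]; lia.
- by case/orP: hs => hs; [exists 0, 0|exists (-1), 0]; lia.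
- by case/orP: hs => hs; [exists (-1), (-1)|exists 0, 0]; lia.
- by case/orP: hs => hs; [exists 0, 0|exists 0, (-1)]; lia.
Qed.

Lemma wt_le n b x y : wt b n x y != 0%N -> (x + y <= n)%N.
Proof.
rewrite /wt /tri_cond; case: (leqP (x + y) n) => // h.
have -> : (x + y + 0 <= n)%N = false by apply/negP; lia.
have -> : (x + y + 1 <= n)%N = false by apply/negP; lia.
by rewrite !andbF; case: b.
Qed.

(** Orbit-stabilizer: six times the inverse weight counts the symmetries
    fixing a point, with signs; a reflection in the stabilizer would cancel the
    count in the sine case, but the sine weights live on interior points. *)
Lemma stab_sum b n x y : (0 < n)%N -> wt b n x y != 0%N ->
  (\sum_(i < 6) sgn R b i * (stab n i x y)%:R) * (wt b n x y)%:R = 6 :> C.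
Proof.
move=> n0 hW; have h := wt_le hW; move: hW.
rewrite !big_ord_recl big_ord0 /= /sgn /wt /tri_cond /stab /=.
have -> : ((x == n) && (y == 0) = (y == 0) && (x + y == n))%N.
  by apply/idP/idP; lia.
have -> : ((x == 0) && (y == n) = (x == 0) && (x + y == n))%N.
  by apply/idP/idP; lia.
have -> : (x + y + 0 <= n)%N by lia.
have -> : (x + y + 1 <= n)%N = ~~ (x + y == n)%N by apply/idP/idP; lia.
rewrite !lt0n.
have : ~~ [&& x == 0, y == 0 & x + y == n]%N by lia.
by case: (x == 0)%N; case: (y == 0)%N; case: (x + y == n)%N; case: b => //= _ _; ring.
Qed.

(** At a node on the side of the triangle, some reflection changes the node by
    a period only, so an odd function vanishes there. *)
Lemma wave_boundary n k x y : (0 < n)%N -> inH k -> (x + y <= n)%N ->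
  ~~ tri_cond n 1 1 1 x y -> wave true k (tnode n x y) = 0.
Proof.
move=> n0 hk h hb.
have anti (i : 'I_6) : (2 < i)%N ->
   (forall j : 'I_6, phi (act j k) (act i (tnode n x y)) = phi (act j k) (tnode n x y)) ->
   wave true k (tnode n x y) = 0.
  move=> i2 hi; have : wave true k (act i (tnode n x y)) = wave true k (tnode n x y).
    by rewrite !wave_sum_freq; congr (_ * _); apply: eq_bigr => j _; rewrite hi.
  rewrite wave_act /sgn i2 /= mulN1r => /eqP.
  by rewrite eq_sym -addr_eq0 -mulr2n -mulr_natl mulf_eq0 pnatr_eq0 /= => /eqP.
have n1 : n%:R != 0 :> R by rewrite pnatr_eq0 -lt0n.
have : [|| x == 0, y == 0 | x + y == n]%N by move: hb; rewrite /tri_cond; lia.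
case/or3P => /eqP e.
- apply: (anti (@Ordinal 6 3 isT)) => // j; rewrite /tnode act_node /tfreq /= e.
  by congr phi; apply: eq_node; lia.
- apply: (anti (@Ordinal 6 5 isT)) => // j; rewrite /tnode act_node /tfreq /= e.
  by congr phi; apply: eq_node; lia.
- apply: (anti (@Ordinal 6 4 isT)) => // j; rewrite /tnode act_node /tfreq /= .
  have := inH_act j hk; move: (act j k) => l hl.
  rewrite (@eq_node _ _ _ _ (x%:Z - n%:Z) (y%:Z - n%:Z) (- ((x%:Z - n%:Z) + (y%:Z - n%:Z)))); [|lia..].
  rewrite -[node R n _]/(inode n _ _) -[RHS]/(phi l (inode n x y)) !phi_inode //.
  case: l hl => -[l1 l2] l3; rewrite /inH /= => hl.
  have -> : ((l1 - l3) * (x%:Z - n%:Z) + (l2 - l3) * (y%:Z - n%:Z))%:~R / (3 * n)%:R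
    = ((l1 - l3) * x%:Z + (l2 - l3) * y%:Z)%:~R / (3 * n)%:R + (l3)%:~R :> R.
    have -> : l3 = - (l1 + l2) by lia.
    rewrite natrM !rmorphD !rmorphM !rmorphD !rmorphN /= !rmorphD /= -[n%:~R]/(n%:R).
    by field.
  by rewrite chiD chi_int mulr1.
Qed.

(** Sine products vanish at boundary nodes, so both weights may be used and
    the cosine quadrature rule covers the sine case. *)
Lemma wt_alternating n k l x y : (0 < n)%N -> inH k ->
  (wt true n x y)%:R * (wave true k (tnode n x y) * l) =
  (wt false n x y)%:R * (wave true k (tnode n x y) * l).
Proof.
move=> n0 hk; case: (leqP (x + y) n) => h; last first.
  have z b : wt b n x y = 0%N by apply/eqP/contraT => /wt_le; lia.
  by rewrite !z.
case: (boolP (tri_cond n 1 1 1 x y)) => hb; last by rewrite wave_boundary // mul0r !mulr0.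
congr (_%:R * _); rewrite /wt hb; move: hb; rewrite /tri_cond => /and3P[-> -> ->].
by have -> : (x + y + 0 <= n)%N by lia.
Qed.

Lemma orthogonality b n k1 k2 l1 l2 : (0 < n)%N ->
  wt b n k1 k2 != 0%N -> wt b n l1 l2 != 0%N ->
  \sum_(x < n.+1) \sum_(y < n.+1)
    (wt b n x y)%:R * (wave b (tfreq k1 k2) (tnode n x y) * wave b (- tfreq l1 l2) (tnode n x y)) =
  if (k1 == l1) && (k2 == l2) then (3 * n ^ 2)%:R / (wt b n l1 l2)%:R else 0.
Proof.
move=> n0 hk hl.
have -> : \sum_(x < n.+1) \sum_(y < n.+1)
    (wt b n x y)%:R * (wave b (tfreq k1 k2) (tnode n x y) * wave b (- tfreq l1 l2) (tnode n x y)) =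
  \sum_(x < n.+1) \sum_(y < n.+1)
    (wt false n x y)%:R * (wave b (tfreq k1 k2) (tnode n x y) * wave b (- tfreq l1 l2) (tnode n x y)).
  apply: eq_bigr => x _; apply: eq_bigr => y _.
  by case: b hk hl => // _ _; apply: wt_alternating => //; exact: inH_tfreq.
under eq_bigr => x _ do under eq_bigr => y _ do rewrite wave_product mulrCA mulr_sumr.
under eq_bigr => x _ do rewrite -mulr_sumr exchange_big /=.
rewrite -mulr_sumr exchange_big /=.
rewrite (eq_bigr (fun i : 'I_6 => [&& k1 == l1 & k2 == l2]%:R * (3 * n ^ 2)%:R * (sgn R b i * (stab n i k1 k2)%:R))).
  rewrite -mulr_sumr; case: (k1 =P l1) => [<-|_] /=; last by rewrite !mul0r mulr0.
  case: (k2 =P l2) => [<-|_] /=; last by rewrite !mul0r mulr0.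
  have := stab_sum n0 hk; set s := \sum_(i < 6) _; set w := (wt _ _ _ _)%:R => hs.
  have w0 : w != 0 by rewrite pnatr_eq0.
  by apply: (mulIf w0); rewrite divfK // mul1r -!mulrA hs mulrCA mulVf ?mulr1 // pnatr_eq0.
move=> i _.
under eq_bigr => x _ do under eq_bigr => y _ do rewrite mulrCA.
under eq_bigr => x _ do rewrite -mulr_sumr.
rewrite -mulr_sumr quadrature //; last first.
  exact: inH_sub (inH_act i (inH_tfreq k1 k2)) (inH_tfreq l1 l2).
rewrite aliases0_tfreq // ?(wt_le hk) ?(wt_le hl) //.
case: (k1 == l1); case: (k2 == l2); case: stab;
  by rewrite /= ?(mul0r, mulr0, mul1r, mulr1) // mulrC.
Qed.
End Quad.

(** * The Lagrange interpolation formula *)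

Section Span.
Variable R : realType.
Local Notation C := R[i].
Local Notation fn := (R * R * R -> C).

Definition lin_closed (P : fn -> Prop) : Prop :=
  [/\ P (fun=> 0), forall f g, P f -> P g -> P (fun t => f t + g t)
    & forall c f, P f -> P (fun t => c * f t)].

Lemma lin_closed_sum (P : fn -> Prop) (I : Type) (r : seq I) (F : I -> fn) :
  lin_closed P -> (forall i, P (F i)) -> P (fun t => \sum_(i <- r) F i t).
Proof.
move=> [P0 PD _] hF; elim: r => [|i r IH].
  by rewrite (_ : (fun _ => _) = fun=> 0) //; apply/funext => t; rewrite big_nil.
rewrite (_ : (fun _ => _) = fun t => F i t + \sum_(i <- r) F i t); first exact: PD.
by apply/funext => t; rewrite big_cons.
Qed.

Lemma cspan_ind (A : set fn) (P : fn -> Prop) : lin_closed P ->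
  (forall e, A e -> P e) -> forall g, cspan A g -> P g.
Proof.
move=> hP hA g [m [c [e [he ->]]]].
apply: (@lin_closed_sum P _ _ (fun i t => c i * e i t) hP) => i.
by case: (hP) => _ _; apply; apply: hA.
Qed.

Lemma cspan_closed (A : set fn) : lin_closed (cspan A).
Proof.
split.
- exists 0%N, (fun=> 0), (fun=> fun=> 0); split; first by case.
  by apply/funext => t; rewrite big_ord0.
- move=> f g [m1 [c1 [e1 [h1 ->]]]] [m2 [c2 [e2 [h2 ->]]]].
  exists (m1 + m2)%N,
    (fun i => match fintype.split i with inl j => c1 j | inr j => c2 j end),
    (fun i => match fintype.split i with inl j => e1 j | inr j => e2 j end).
  split; first by move=> i; case: fintype.split.
  apply/funext => t; rewrite big_split_ord /=; congr (_ + _); apply: eq_bigr => i _.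
    by rewrite -[lshift _ _]/(unsplit (inl i)) unsplitK.
  by rewrite -[rshift _ _]/(unsplit (inr i)) unsplitK.
- move=> c f [m1 [c1 [e1 [h1 ->]]]].
  exists m1, (fun i => c * c1 i), e1; split => //.
  by apply/funext => t; rewrite mulr_sumr; apply: eq_bigr => i _; rewrite mulrA.
Qed.

Lemma cspan_gen (A : set fn) e : A e -> cspan A e.
Proof.
move=> he; exists 1%N, (fun=> 1), (fun=> e); split => //.
by apply/funext => t; rewrite big_ord1 mul1r.
Qed.

Definition space (b : bool) (n : nat) : set fn :=
  if b then TSspace n else TCspace n.
Definition freqs (b : bool) (n : nat) : set freq :=
  if b then Lambda_int n else Lambda n.

Lemma space_closed b n : lin_closed (space b n).
Proof. by case: b; apply: cspan_closed. Qed.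

Lemma freqs_tfreq b n (j : int * int * int) : (0 < n)%N -> freqs b n j ->
  exists x y, [/\ j = tfreq x y, wt b n x y != 0%N, (x < n.+1)%N & (y < n.+1)%N].
Proof.
case: j => -[j1 j2] j3 n0 hj.
have [h0 [h1 h2] h3] : [/\ j1 + j2 + j3 = 0, 0 <= j1 /\ 0 <= j2 & - j3 <= n%:Z].
  by case: b hj => -[/=]; rewrite /inH /= => h [? ? ?]; split; try split; lia.
exists `|j1|%N, `|j2|%N; split; try lia.
  by rewrite /tfreq; congr (_, _, _); lia.
rewrite /wt; case: b hj => -[_ [/= g1 g2 g3]].
  by have -> : tri_cond n 1 1 1 `|j1| `|j2| by rewrite /tri_cond; lia.
by rewrite /tri_cond; lia.
Qed.

Lemma tfreq_freqs b n x y : (0 < n)%N -> wt b n x y != 0%N -> freqs b n (tfreq x y).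
Proof.
move=> n0 hW; have h := wt_le hW; case: b hW => hW; split.
- exact: inH_tfreq.
- by move: hW; rewrite /wt; case E: (tri_cond _ _ _ _ _ _) => // _; move: E; rewrite /tri_cond /tfreq /= => E; split; lia.
- exact: inH_tfreq.
- by rewrite /tfreq /=; split; lia.
Qed.


(** Membership of the unnormalized wave: the sine space is spanned by TS_k,
    which differs from it by the factor 1/i. *)
Lemma space_gen b n x y : (0 < n)%N -> wt b n x y != 0%N ->
  space b n (fun t => wave b (tfreq x y) t).
Proof.
move=> n0 hW; have := tfreq_freqs n0 hW; case: b {hW} => h /=.
- have [_ _ PZ] := space_closed true n.
  have -> : wave true (tfreq x y) = fun t : R * R * R => 'i * TS (tfreq x y) t :> C.
    apply/funext => t; rewrite /TS -[-1]/(psign R true) symPE mulrA mulfV ?mul1r //.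
    exact: neq0Ci.
  by apply: (PZ); apply: cspan_gen; exists (tfreq x y).
- apply: cspan_gen; exists (tfreq x y) => //.
  by apply/funext => t; rewrite /TC -[1]/(psign R false) symPE.
Qed.

Lemma space_ind b n (P : fn -> Prop) : (0 < n)%N -> lin_closed P ->
  (forall x y, wt b n x y != 0%N -> (x < n.+1)%N -> (y < n.+1)%N -> P (wave b (tfreq x y))) ->
  forall g, space b n g -> P g.
Proof.
move=> n0 hP hB g hg; have [_ _ PZ] := hP.
move: hg; rewrite /space; case: b hB => hB; apply: cspan_ind => // e [k hk <-].
  have [x [y [-> hW hx hy]]] := @freqs_tfreq true n k n0 hk.
  rewrite /TS -[-1]/(psign R true); under eq_fun do rewrite symPE.
  by apply: (PZ); apply: hB.
have [x [y [-> hW hx hy]]] := @freqs_tfreq false n k n0 hk.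
rewrite /TC -[1]/(psign R false) (_ : symP _ _ = wave false (tfreq x y)); first exact: hB.
by apply/funext => t; rewrite symPE.
Qed.

(** The reproducing kernel of the discrete inner product, with the conjugate
    wave written as the wave of the opposite frequency. *)
Definition lagrange_basis b n (x y : nat) (t : R * R * R) : C :=
  (wt b n x y)%:R / (3 * n ^ 2)%:R *
  \sum_(u < n.+1) \sum_(v < n.+1)
    (wt b n u v)%:R * (wave b (tfreq u v) t * wave b (- tfreq u v) (tnode R n x y)).

Definition lagrange b n (f : fn) (t : R * R * R) : C :=
  \sum_(x < n.+1) \sum_(y < n.+1) f (tnode R n x y) * lagrange_basis b n x y t.

Lemma lagrange_space b n f : (0 < n)%N -> space b n (lagrange b n f).
Proof.
move=> n0; have hc := space_closed b n; have [P0 PD PZ] := hc.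
apply: lin_closed_sum => // x; apply: lin_closed_sum => // y.
apply: (PZ); apply: (PZ); apply: lin_closed_sum => // u; apply: lin_closed_sum => // v.
have [e|/negP e] := boolP (wt b n u v == 0%N).
  by rewrite (eqP e) (_ : (fun _ => _) = fun=> 0) //; apply/funext => t; rewrite mul0r.
under eq_fun do rewrite [wave b (tfreq u v) _ * _]mulrC.
by apply: (PZ); apply: (PZ); apply: space_gen => //; apply/negP.
Qed.

Lemma card_neq0 n : (0 < n)%N -> (3 * n ^ 2)%:R != 0 :> C.
Proof. by move=> n0; rewrite pnatr_eq0; lia. Qed.

Lemma sum2_delta n (u v : nat) (G : nat -> nat -> C) : (u < n.+1)%N -> (v < n.+1)%N ->
  \sum_(x < n.+1) \sum_(y < n.+1) (if (u == x) && (v == y) then G x y else 0) = G u v.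
Proof.
move=> hu hv; rewrite (bigD1 (Ordinal hu)) //= [X in _ + X]big1 ?addr0; last first.
  move=> x hx; apply: big1 => y _.
  by case: ifP => // /andP[/eqP e _]; case/eqP: hx; apply/val_inj.
rewrite (bigD1 (Ordinal hv)) //= [X in _ + X]big1 ?addr0 ?eqxx //; last first.
  by move=> y hy; case: ifP => // /andP[_ /eqP e]; case/eqP: hy; apply/val_inj.
Qed.

(** Reproduction of one generator, by orthogonality in the node index. *)
Lemma lagrange_wave b n u v t : (0 < n)%N -> (u < n.+1)%N -> (v < n.+1)%N ->
  wt b n u v != 0%N -> lagrange b n (wave b (tfreq u v)) t = wave b (tfreq u v) t.
Proof.
move=> n0 hu hv hW; rewrite /lagrange /lagrange_basis.
have N0 := card_neq0 n0.
transitivity (\sum_(p < n.+1) \sum_(q < n.+1)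
  (wt b n p q)%:R / (3 * n ^ 2)%:R * wave b (tfreq p q) t *
  \sum_(x < n.+1) \sum_(y < n.+1)
   (wt b n x y)%:R * (wave b (tfreq u v) (tnode R n x y) * wave b (- tfreq p q) (tnode R n x y))).
  under eq_bigr => x _ do under eq_bigr => y _ do rewrite !mulr_sumr.
  under eq_bigr => x _ do under eq_bigr => y _ do under eq_bigr => p _ do rewrite !mulr_sumr.
  under eq_bigr => x _ do rewrite exchange_big /=.
  rewrite exchange_big /=; apply: eq_bigr => p _.
  under eq_bigr => x _ do rewrite exchange_big /=.
  rewrite exchange_big /=; apply: eq_bigr => q _.
  rewrite mulr_sumr; apply: eq_bigr => x _; rewrite mulr_sumr; apply: eq_bigr => y _.
  by ring.
rewrite -[RHS](sum2_delta (fun p q => wave b (tfreq p q) t) hu hv).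
apply: eq_bigr => p _; apply: eq_bigr => q _.
have [e|hp] := eqVneq (wt b n p q) 0%N.
  case: ifP => [/andP[/eqP e1 /eqP e2]|_]; first by move: hW; rewrite e1 e2 e.
  by rewrite e !mul0r.
rewrite orthogonality //; case: ifP => _; last by rewrite mulr0.
have w0 : (wt b n p q)%:R != 0 :> C by rewrite pnatr_eq0.
by rewrite mulrAC -[_ / _]invf_div mulVf ?mul1r // mulf_neq0 ?invr_eq0.
Qed.

Lemma lagrange_lin_closed b n : lin_closed (fun g => forall t, g t = lagrange b n g t).
Proof.
split.
- by move=> t; rewrite /lagrange; under eq_bigr do under eq_bigr do rewrite mul0r;
    rewrite !big1 // => i _; rewrite big1.
- move=> f g hf hg t; rewrite hf hg /lagrange -big_split; apply: eq_bigr => x _.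
  by rewrite -big_split; apply: eq_bigr => y _; rewrite mulrDl.
- move=> c f hf t; rewrite [in LHS]hf /lagrange mulr_sumr; apply: eq_bigr => x _.
  by rewrite mulr_sumr; apply: eq_bigr => y _; rewrite mulrA.
Qed.

Lemma lagrange_repro b n g t : (0 < n)%N -> space b n g -> g t = lagrange b n g t.
Proof.
move=> n0 hg; move: g hg t; apply: space_ind => //; first exact: lagrange_lin_closed.
by move=> x y hW hx hy t; rewrite lagrange_wave.
Qed.

Lemma phi_node_sym n k l : phi k (node R n l) = phi l (node R n k).
Proof.
rewrite !phiE; congr (chi (_ / _)); rewrite /dot /node /=.
by congr (_ + _ + _); exact: mulrCA.
Qed.

(** The exponent k . j / (3n) is symmetric in k and j, and the group is closed
    under adjoints. *)
Lemma wave_node_sym b n k l : wave b k (node R n l) = wave b l (node R n k).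
Proof.
rewrite wave_sum_freq [RHS]/wave /symmetrize; congr (_ * _); apply: eq_bigr => i _.
by rewrite phi_node_sym act_node.
Qed.

Lemma wave_node_symN b n k l : wave b (- k) (node R n l) = wave b (- l) (node R n k).
Proof.
rewrite wave_node_sym /wave /symmetrize; congr (_ * _); apply: eq_bigr => i _.
rewrite phiN act_node; congr (_ * phi _ _).
rewrite /node; case: k => -[k1 k2] k3; case: i => -[|[|[|[|[|[|]]]]]] //= _; 
 rewrite tripN ?opprK ?rmorphN /= ?mulNr ?opprK //.
Qed.

(** Interpolation, by orthogonality in the frequency index: exchanging nodes
    and frequencies reduces it to the relation used for reproduction. *)
Lemma lagrange_node b n f x y : (0 < n)%N -> (x < n.+1)%N -> (y < n.+1)%N ->
  wt b n x y != 0%N -> lagrange b n f (tnode R n x y) = f (tnode R n x y).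
Proof.
move=> n0 hx hy hW.
rewrite -[RHS](sum2_delta (fun p q => f (tnode R n p q)) hx hy).
apply: eq_bigr => p _; apply: eq_bigr => q _; rewrite /lagrange_basis.
have [e|hp] := eqVneq (wt b n p q) 0%N.
  case: ifP => [/andP[/eqP e1 /eqP e2]|_]; first by move: hW; rewrite e1 e2 e.
  by rewrite e !mul0r mulr0.
under eq_bigr => u _ do under eq_bigr => v _ do
  rewrite /tnode wave_node_sym wave_node_symN -/(tnode R n u v).
rewrite orthogonality //; case: ifP => _; last by rewrite !mulr0.
have N0 := card_neq0 n0.
have w0 : (wt b n p q)%:R != 0 :> C by rewrite pnatr_eq0.
by rewrite -(invf_div (wt b n p q)%:R (3 * n ^ 2)%:R) mulfV ?mulr1 // mulf_neq0 ?invr_eq0.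
Qed.

Definition interp b n (f : fn) : fn := if b then interpTS n f else interpTC n f.

Lemma interpE b n f : (0 < n)%N -> interp b n f = lagrange b n f.
Proof.
move=> n0.
pose P := [set g : fn | space b n g /\
  forall j, freqs b n j -> g (node R n j) = f (node R n j)].
have -> : interp b n f = xget (fun=> 0) P by case: b @P.
have [hs hv] : P (xget (fun=> 0) P).
  apply: xgetPex; exists (lagrange b n f); split; first exact: lagrange_space.
  move=> j hj; have [x [y [-> hW hx hy]]] := freqs_tfreq n0 hj.
  exact: lagrange_node.
apply/funext => t; rewrite (lagrange_repro t n0 hs).
apply: eq_bigr => x _; apply: eq_bigr => y _.
have [e|hW] := eqVneq (wt b n x y) 0%N; first by rewrite /lagrange_basis e !mul0r !mulr0.
by congr (_ * _); apply: hv; apply: tfreq_freqs.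
Qed.
End Span.

(** * A one-dimensional sum of order n log n *)

Section OneDim.
Variable R : realType.
Local Notation C := R[i].

(** A single expression equivalent to min(N, 1/d) up to a factor 2, with no
    case distinction and monotone in d. *)
Definition damp (N : nat) (d : R) : R := (d + N%:R^-1)^-1.
Definition chord (x : R) : R := cmod (1 - chi x).

Lemma chord_ge0 x : 0 <= chord x.
Proof. exact: cmod_ge0. Qed.

Lemma damp_gt0 N d : (0 < N)%N -> 0 <= d -> 0 < damp N d.
Proof. by move=> N0 d0; rewrite invr_gt0 ltr_wpDl // invr_gt0 ltr0n. Qed.

Lemma damp_le N d e : (0 < N)%N -> 0 <= d -> d <= e -> damp N e <= damp N d.
Proof.
move=> N0 d0 de; have Np : 0 < N%:R^-1 :> R by rewrite invr_gt0 ltr0n.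
by rewrite lef_pV2 ?posrE ?lerD2r //; apply: ltr_wpDl => //; apply: le_trans de.
Qed.

(** A sum of at most N terms of modulus at most 1 which telescopes after
    multiplication by z has modulus at most N and at most 2/|z|; adding both
    bounds gives the estimate by [damp].  Geometric series are the case z = X - 1. *)
Lemma telescoping_bound N (z : C) (f g : nat -> C) p r : (0 < N)%N -> (r - p <= N)%N ->
  (forall x, (p <= x < r)%N -> cmod (g x) <= 1) ->
  (forall x, (p <= x <= r)%N -> cmod (f x) <= 1) ->
  (forall x, (p <= x < r)%N -> z * g x = f x.+1 - f x) ->
  cmod (\sum_(p <= x < r) g x) <= 3 * damp N (cmod z).
Proof.
move=> N0 rN hg hf hz.
have N0' : 0 < N%:R :> R by rewrite ltr0n.
have Np : 0 < N%:R^-1 :> R by rewrite invr_gt0.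
set Sg := \sum_(p <= x < r) g x.
have h1 : cmod Sg <= N%:R.
  apply: le_trans (cmod_sum _ _ _) _.
  have : \sum_(p <= i < r) cmod (g i) <= \sum_(p <= i < r) (1:R).
    by rewrite big_nat [leRHS]big_nat; apply: ler_sum => i hi; apply: hg.
  move=> h; apply: le_trans h _; rewrite big_const_nat iter_addr_0 ler_nat //.
have h2 : cmod z * cmod Sg <= 2.
  have [pr|rp] := leqP p r; last first.
    by rewrite /Sg big_geq ?cmod0 ?mulr0 // ltnW.
  rewrite -cmodM mulr_sumr (_ : \sum_(p <= i < r) _ = f r - f p).
    apply: le_trans (cmod_sub _ _) _.
    have := hf r; have := hf p; rewrite !leqnn pr => /(_ isT) ? /(_ isT) ?; lra.
  rewrite -(telescope_sumr f pr) big_nat [RHS]big_nat; apply: eq_bigr => i hi.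
  exact: hz.
have h3 : cmod Sg * N%:R^-1 <= 1 by rewrite ler_pdivrMr // mul1r.
have z0 := cmod_ge0 z.
rewrite /damp ler_pdivlMr; last by apply: ltr_wpDl.
by nra.
Qed.

Lemma periodic_shift (M : nat) (F : int -> R) (c : int) :
  (forall z, F (z + M%:Z) = F z) ->
  \sum_(p < M) F (p%:Z + c) = \sum_(p < M) F p%:Z.
Proof.
move=> hF.
have nshift (F' : int -> R) (n : nat) : (forall z, F' (z + M%:Z) = F' z) ->
    \sum_(p < M) F' (p%:Z + n%:Z) = \sum_(p < M) F' p%:Z.
  move=> hF'; elim: n => [|n IH]; first by under eq_bigr do rewrite addr0.
  rewrite -IH; case: M hF' {IH hF} => [|M] hF'; first by rewrite !big_ord0.
  rewrite big_ord_recr [RHS]big_ord_recl /= addrC; congr (_ + _).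
    by rewrite -(hF' (0%:Z + n%:Z)); congr F'; lia.
  by apply: eq_bigr => i _; congr F'; rewrite /bump /=; lia.
case: (leP 0 c) => hc.
  by have := nshift F `|c|%N hF; rewrite gez0_abs.
have := nshift (fun z => F (z + c)) `|c|%N; rewrite ltz0_abs // => <-.
  by apply: eq_bigr => p _; congr F; lia.
by move=> z; rewrite -[RHS]hF; congr F; lia.
Qed.

Lemma chord_int x (z : int) : chord (x + z%:~R) = chord x.
Proof. by rewrite /chord chiD chi_int mulr1. Qed.

Lemma chordN x : chord (- x) = chord x.
Proof.
by rewrite /chord -[1 - chi x]opprB cmodN -[LHS]mul1r -(cmod_chi x) -cmodM mulrBr mulr1 mulrC chiN.
Qed.

Lemma chord_lower x : 0 <= x <= 1 -> (2 * x <= chord x) \/ (2 * (1 - x) <= chord x).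
Proof.
move=> /andP[x0 x1]; case: (leP x (1 / 2)) => h.
  by left; have := @cmod_1chi_lower R x; rewrite ger0_norm //; apply.
right; have := chord_int x (-1); rewrite rmorphN1 => e.
have := @cmod_1chi_lower R (x - 1); rewrite -/(chord _) e ler0_norm ?opprB; last lra.
by apply; lra.
Qed.

Definition harm M : R := \sum_(p < M) (p.+1%:R)^-1.

Lemma harm_le M : (0 < M)%N -> harm M <= 1 + ln M%:R.
Proof.
case: M => // M _; rewrite /harm; elim: M => [|M IH].
  by rewrite big_ord_recl big_ord0 ln1 invr1.
rewrite big_ord_recr /=.
suff : (M.+2%:R)^-1 <= ln M.+2%:R - ln M.+1%:R :> R.
  by move=> h; have := lerD IH h; move/le_trans; apply; move: h; set A := ln _; set D := ln _; lra.
have := @le_ln1Dx R (- (M.+2%:R)^-1).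
have M2 : 1 < M.+2%:R :> R by rewrite ltr1n.
have -> : 1 + - (M.+2%:R)^-1 = M.+1%:R / M.+2%:R :> R.
  have : 0 < M.+1%:R :> R by rewrite ltr0n.
  by rewrite -[M.+2%:R]natr1; move: (M.+1%:R) => m m0; field; lra.
rewrite ln_div ?posrE ?ltr0n // => h.
have : -1 < - M.+2%:R^-1 :> R by rewrite ltrN2 invf_lt1 //; lra.
by move=> /h; rewrite lerNr opprB.
Qed.

(** After a periodic shift the phases are (p + r)/(3n) up to sign, with
    0 <= r < 1, and the distance to the nearest integer is at least p/(3n) or
    (3n - 1 - p)/(3n); the two halves each give a harmonic sum. *)
Lemma sum_damp_chord (n : nat) (al : R) : (0 < n)%N ->
  \sum_(p < 3 * n) damp n.+1 (chord (al - p%:R / (3 * n)%:R)) <= 3 * n.+1%:R * harm (3 * n).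
Proof.
move=> n0; set M := (3 * n)%N.
have M0 : (0 < M)%N by rewrite muln_gt0.
have M0' : 0 < M%:R :> R by rewrite ltr0n.
pose F (z : int) := damp n.+1 (chord (al - z%:~R / M%:R)).
pose c := Num.ceil (al * M%:R).
have hper z : F (z + M%:Z) = F z.
  rewrite /F -(chord_int (al - z%:~R / M%:R) (-1)); congr (damp _ (chord _)).
  by rewrite rmorphD rmorphN1 /= -[M%:~R]/(M%:R); field; rewrite gt_eqF.
rewrite -[leLHS](periodic_shift c hper).
pose r := c%:~R - al * M%:R.
have /andP[hr0 hr1] : 0 <= r < 1.
  have := ceil_itv (al * M%:R); rewrite -/c /r intrB => /andP[]; lra.
have hN : n.+1%:R != 0 :> R by rewrite pnatr_eq0.
have Np : 0 < n.+1%:R :> R by rewrite ltr0n.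
have term (x : R) (q : nat) : q%:R / M%:R <= x -> damp n.+1 (2 * x) <= (3 / 2) * n.+1%:R * q.+1%:R^-1.
  move=> hx.
  have hMn : M%:R <= 3 * n.+1%:R :> R by rewrite -natrM ler_nat /M; lia.
  have q0 : 0 <= q%:R :> R by rewrite ler0n.
  have A : 0 <= 2 * (q%:R / (3 * n.+1%:R)) :> R by rewrite mulr_ge0 // divr_ge0 // mulr_ge0.
  have D : 2 * (q%:R / (3 * n.+1%:R)) <= 2 * x.
    by rewrite ler_pM2l // (le_trans _ hx) // ler_wpM2l // lef_pV2 ?posrE ?mulr_gt0.
  apply: le_trans (damp_le (ltn0Sn n) A D) _.
  have np : 0 < (q%:R + 1 : R) by lra.
  rewrite /damp -[q.+1%:R]natr1 invf_ple ?posrE; first last.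
  - by rewrite mulr_gt0 ?invr_gt0 // mulr_gt0 // divr_gt0.
  - by apply: ltr_wpDl; rewrite ?invr_gt0 // mulr_ge0 // divr_ge0 // mulr_ge0.
  rewrite !invfM !invrK.
  have -> : 2 * (q%:R * (3^-1 * n.+1%:R^-1)) + n.+1%:R^-1 = (2 / 3 * q%:R + 1) / n.+1%:R :> R.
    by field.
  have -> : 3^-1 * 2 * n.+1%:R^-1 * (q%:R + 1) = (2 / 3 * q%:R + 2 / 3) / n.+1%:R :> R.
    by field.
  by rewrite ler_pM2r ?invr_gt0 //; lra.
apply: (@le_trans _ _ (\sum_(p < M) ((3 / 2) * n.+1%:R * p.+1%:R^-1 + (3 / 2) * n.+1%:R * (rev_ord p).+1%:R^-1))).
  apply: ler_sum => p _; rewrite /F.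
  pose th := (p%:R + r) / M%:R.
  have -> : al - (p%:Z + c)%:~R / M%:R = - th.
    by rewrite /th /r rmorphD /= -[p%:~R]/(p%:R); field; rewrite gt_eqF.
  have pM : p.+1%:R <= M%:R :> R by rewrite ler_nat.
  have p0 : 0 <= p%:R :> R by rewrite ler0n.
  have hp : p%:R + 1 <= M%:R :> R by rewrite natr1.
  have th01 : 0 <= th <= 1.
    apply/andP; split; first by rewrite /th; apply: divr_ge0; [lra | exact: ltW].
    by rewrite /th ler_pdivrMr // mul1r; lra.
  have /andP[th_ge0 th_le1] := th01.
  have pos1 : 0 <= (3 / 2) * n.+1%:R * p.+1%:R^-1 :> R by rewrite mulr_ge0 ?invr_ge0 // mulr_ge0.
  have pos2 : 0 <= (3 / 2) * n.+1%:R * (rev_ord p).+1%:R^-1 :> R by rewrite mulr_ge0 ?invr_ge0 // mulr_ge0.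
  rewrite chordN; case: (chord_lower th01) => h.
    apply: le_trans (damp_le _ _ h) _ => //; first by rewrite mulr_ge0 //; lra.
    apply: le_trans (term _ p _) _; last by rewrite lerDl.
    by rewrite /th ler_pM2r ?invr_gt0 //; lra.
  apply: le_trans (damp_le _ _ h) _ => //; first by rewrite mulr_ge0 //; lra.
  apply: le_trans (term _ (rev_ord p) _) _; last by rewrite lerDr.
  rewrite /= natrB // /th ler_pdivrMr // mulrBl mul1r divfK ?gt_eqF //.
  by rewrite -natr1; lra.
rewrite big_split /= -!mulr_sumr -/(harm M).
have -> : \sum_(i < M) (M - i.+1).+1%:R^-1 = harm M.
  by rewrite /harm [RHS](reindex_inj rev_ord_inj).
lra.
Qed.

End OneDim.

(** * Bounds for the triangular Dirichlet kernel *)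

Section Kernel.
Variable R : realType.
Local Notation C := R[i].

Lemma sum_itv (V : nmodType) (N a b : nat) (h : nat -> V) : (b <= N)%N ->
  \sum_(x < N) (if (a <= x < b)%N then h x else 0) = \sum_(a <= x < b) h x.
Proof.
move=> bN; rewrite -big_mkcond -(big_mkord (fun x => (a <= x < b)%N) h) /=.
rewrite (big_nat_widen _ _ _ _ _ bN) /=.
by rewrite (big_nat_widenl a 0) //; apply: eq_bigl => i; rewrite andbC.
Qed.

Lemma tri_sum (n e1 e2 e3 : nat) (h : nat -> nat -> C) :
  \sum_(x < n.+1) \sum_(y < n.+1) (tri_cond n e1 e2 e3 x y)%:R * h x y =
  \sum_(e1 <= x < n.+1 - e2 - e3) \sum_(e2 <= y < n.+1 - e3 - x) h x y.
Proof.
have hh : (n.+1 - e2 - e3 <= n.+1)%N by lia.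
rewrite -(sum_itv _ _ hh); apply: eq_bigr => x _.
have hx : (n.+1 - e3 - x <= n.+1)%N by lia.
case: ifP => h1.
  rewrite -(sum_itv _ _ hx); apply: eq_bigr => y _.
  have -> : tri_cond n e1 e2 e3 x y = (e2 <= y < n.+1 - e3 - x)%N.
    by rewrite /tri_cond; apply/idP/idP; lia.
  by case: ifP => _; rewrite ?mul1r ?mul0r.
rewrite big1 // => y _; have -> : tri_cond n e1 e2 e3 x y = false.
  by rewrite /tri_cond; apply/negP; lia.
by rewrite mul0r.
Qed.

Lemma cmod_mulX (X Y : C) a b : cmod X = 1 -> cmod Y = 1 -> cmod (X ^+ a * Y ^+ b) = 1.
Proof. by move=> hX hY; rewrite cmodM !cmodX hX hY !expr1n mulr1. Qed.

(** Summing first over x for each y gives N times a geometric bound in X.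
    Multiplying by 1 - Y instead leaves the two one-dimensional sums
    over X^x and over (X/Y)^x.  Together they bound the sum times (|1 - Y| + 1/N),
    which is the inverse of the factor in Y. *)
Lemma tri_bound (n e1 e2 e3 : nat) (X Y : C) : cmod X = 1 -> cmod Y = 1 ->
  cmod (\sum_(x < n.+1) \sum_(y < n.+1) (tri_cond n e1 e2 e3 x y)%:R * (X ^+ x * Y ^+ y)) <=
  6 * (damp n.+1 (cmod (1 - Y)) * (damp n.+1 (cmod (1 - X)) + damp n.+1 (cmod (X - Y)))).
Proof.
move=> hX hY; set N := n.+1.
have hXX a : cmod (X ^+ a) = 1 by rewrite cmodX hX expr1n.
have hYY a : cmod (Y ^+ a) = 1 by rewrite cmodX hY expr1n.
have aX0 : 0 < damp N (cmod (1 - X)) by apply: damp_gt0 => //; exact: cmod_ge0.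
have aXY0 : 0 < damp N (cmod (X - Y)) by apply: damp_gt0 => //; exact: cmod_ge0.
set Sg := \sum_(x < n.+1) _.
have B1 : cmod Sg <= N%:R * (3 * damp N (cmod (1 - X))).
  rewrite /Sg exchange_big /=; apply: le_trans (cmod_sum _ _ _) _.
  have -> : N%:R * (3 * damp N (cmod (1 - X))) = \sum_(y < N) 3 * damp N (cmod (1 - X)).
    by rewrite sumr_const card_ord mulr_natl.
  apply: ler_sum => y _.
  pose b := if (e2 <= y)%N then (n.+1 - e3 - y)%N else 0%N.
  have -> : \sum_(i < n.+1) (tri_cond n e1 e2 e3 i y)%:R * (X ^+ i * Y ^+ y) =
      (\sum_(e1 <= i < b) X ^+ i) * Y ^+ y.
    have hb : (b <= n.+1)%N by rewrite /b; case: ifP; lia.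
    rewrite -(sum_itv _ _ hb) mulr_suml; apply: eq_bigr => i _.
    have -> : tri_cond n e1 e2 e3 i y = (e1 <= i < b)%N.
      by rewrite /tri_cond /b; case: ifP => h; apply/idP/idP; lia.
    by case: ifP => _; rewrite ?mul1r ?mul0r.
  rewrite cmodM hYY mulr1 -[cmod (1 - X)]cmodN opprB.
  apply: (@telescoping_bound _ _ _ (fun i => X ^+ i)) => //.
  - by rewrite /b; case: ifP; lia.
  - by move=> i _; rewrite hXX.
  - by move=> i _; rewrite hXX.
  - by move=> i _; rewrite exprS; ring.
have B2 : cmod (1 - Y) * cmod Sg <= 3 * damp N (cmod (1 - X)) + 3 * damp N (cmod (X - Y)).
  rewrite -cmodM /Sg (tri_sum n e1 e2 e3 (fun x y => X ^+ x * Y ^+ y)).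
  pose r := (n.+1 - e2 - e3)%N.
  have -> : (1 - Y) * \sum_(e1 <= x < r) \sum_(e2 <= y < n.+1 - e3 - x) X ^+ x * Y ^+ y =
    Y ^+ e2 * (\sum_(e1 <= x < r) X ^+ x) - \sum_(e1 <= x < r) X ^+ x * Y ^+ (n.+1 - e3 - x).
    rewrite !mulr_sumr -sumrB big_nat [RHS]big_nat; apply: eq_bigr => x hx.
    rewrite -mulr_sumr mulrCA -[1 - Y]opprB mulNr mulr_sumr.
    under eq_bigr => y _ do rewrite mulrBl mul1r -exprS.
    by rewrite telescope_sumr; [ring | rewrite /r in hx; lia].
  apply: le_trans (cmod_sub _ _) _; rewrite cmodM hYY mul1r; apply: lerD.
    rewrite -[cmod (1 - X)]cmodN opprB.
    apply: (@telescoping_bound _ _ _ (fun i => X ^+ i)) => //; rewrite ?/r; try lia.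
    - by move=> i _; rewrite hXX.
    - by move=> i _; rewrite hXX.
    - by move=> i _; rewrite exprS; ring.
  (* The second sum telescopes under multiplication by X - Y, so that no
     division by Y is needed. *)
  apply: (@telescoping_bound _ _ _ (fun i => X ^+ i * Y ^+ (n.+2 - e3 - i))) => //; rewrite ?/r; try lia.
  - by move=> i _; rewrite cmod_mulX.
  - by move=> i _; rewrite cmod_mulX.
  - move=> i hi.
    have -> : (n.+2 - e3 - i.+1 = n.+1 - e3 - i)%N by lia.
    have -> : (n.+2 - e3 - i = (n.+1 - e3 - i).+1)%N by lia.
    by rewrite !exprS; ring.
have d0 := cmod_ge0 (1 - Y); have S0 := cmod_ge0 Sg.
have N0 : 0 < N%:R :> R by rewrite ltr0n.
have B3 : cmod Sg * N%:R^-1 <= 3 * damp N (cmod (1 - X)).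
  by rewrite ler_pdivrMr // mulrC.
have key : cmod Sg * (cmod (1 - Y) + N%:R^-1) <= 6 * (damp N (cmod (1 - X)) + damp N (cmod (X - Y))).
  by rewrite mulrDr [cmod Sg * cmod _]mulrC; lra.
rewrite mulrCA /(damp N (cmod (1 - Y))) ler_pdivlMl; last by apply: ltr_wpDl; rewrite ?invr_gt0.
by rewrite mulrC.
Qed.

(** An injective pair of indices turns a single sum of products into part of
    a product of sums. *)
Lemma sum_mul_inj_le (I : finType) (P : pred I) (al be : I -> nat) (K : nat) (F G : nat -> R) :
  (forall p, 0 <= F p) -> (forall p, 0 <= G p) ->
  (forall i, P i -> (al i < K)%N) -> (forall i, P i -> (be i < K)%N) ->
  (forall i j, P i -> P j -> al i = al j -> be i = be j -> i = j) ->
  \sum_(i | P i) F (al i) * G (be i) <= (\sum_(p < K) F p) * (\sum_(q < K) G q).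
Proof.
move=> F0 G0 hal hbe inj.
case: K hal hbe => [|K] hal hbe.
  by rewrite big_pred0 ?big_ord0 ?mul0r // => i; apply/negP => /hal.
rewrite big_distrlr pair_bigA /=.
pose f i : 'I_K.+1 * 'I_K.+1 := (inord (al i), inord (be i)).
rewrite (eq_bigr (fun i => F (f i).1 * G (f i).2)); last first.
  by move=> i Pi; rewrite /f /= !inordK ?hal ?hbe.
have finj : {in [set i | P i]%SET &, injective f}.
  move=> i j; rewrite !inE => Pi Pj [h1 h2]; apply: inj => //.
    by rewrite -[al i](@inordK K) ?hal // h1 inordK ?hal.
  by rewrite -[be i](@inordK K) ?hbe // h2 inordK ?hbe.
rewrite (eq_bigl (fun i => i \in [set i | P i]%SET)); last by move=> i; rewrite inE.
rewrite -(big_imset (fun p : 'I_K.+1 * 'I_K.+1 => F p.1 * G p.2) finj) /=.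
rewrite [leRHS](bigID (fun p => p \in f @: [set i | P i]%SET)) /= lerDl.
by apply: sumr_ge0 => p _; rewrite mulr_ge0.
Qed.

(** On the plane, the exponential of frequency (x, y, -x-y) is chi of
    x phase1 + y phase2. *)
Definition phase1 (u : R * R * R) : R := (u.1.1 - u.2) / 3.
Definition phase2 (u : R * R * R) : R := (u.1.2 - u.2) / 3.

Lemma phi_tfreq x y u : phi (tfreq x y) u = chi (phase1 u) ^+ x * chi (phase2 u) ^+ y.
Proof.
rewrite -!chiX -chiD phiE; congr chi; rewrite /dot /phase1 /phase2 /tfreq /= rmorphN rmorphD /=.
by rewrite -[x%:~R]/(x%:R) -[y%:~R]/(y%:R); field.
Qed.

Definition tri_kernel b n (u : R * R * R) : C :=
  \sum_(x < n.+1) \sum_(y < n.+1) (wt b n x y)%:R * phi (tfreq x y) u.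

Definition kernel_majorant n (u : R * R * R) : R :=
  damp n.+1 (chord (phase2 u)) * (damp n.+1 (chord (phase1 u)) + damp n.+1 (chord (phase1 u - phase2 u))).

Lemma tri_kernel_bound b n u : cmod (tri_kernel b n u) <= 36 * kernel_majorant n u.
Proof.
pose T e1 e2 e3 := \sum_(x < n.+1) \sum_(y < n.+1)
  (tri_cond n e1 e2 e3 x y)%:R * (chi (phase1 u) ^+ x * chi (phase2 u) ^+ y).
have hT e1 e2 e3 : cmod (T e1 e2 e3) <= 6 * kernel_majorant n u.
  apply: le_trans (tri_bound _ _ _ _ (cmod_chi _) (cmod_chi _)) _.
  rewrite /kernel_majorant /chord; have -> : cmod (chi (phase1 u) - chi (phase2 u)) = cmod (1 - chi (phase1 u - phase2 u)).
    rewrite -[RHS]mul1r -(cmod_chi (phase2 u)) -cmodM mulrBr mulr1 -chiD addrCA subrr addr0.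
    by rewrite -cmodN opprB.
  by [].
case: b; rewrite /tri_kernel.
  have -> : \sum_(x < n.+1) \sum_(y < n.+1) (wt true n x y)%:R * phi (tfreq x y) u = 6%:R * T 1%N 1%N 1%N.
    rewrite /T mulr_sumr; apply: eq_bigr => x _; rewrite mulr_sumr; apply: eq_bigr => y _.
    by rewrite /wt natrM phi_tfreq -!mulrA.
  by rewrite cmodM cmod_nat; have := hT 1%N 1%N 1%N; lra.
have -> : \sum_(x < n.+1) \sum_(y < n.+1) (wt false n x y)%:R * phi (tfreq x y) u =
   T 1%N 0%N 0%N + T 0%N 1%N 0%N + T 0%N 0%N 1%N + T 1%N 1%N 0%N + T 1%N 0%N 1%N + T 0%N 1%N 1%N.
  rewrite /T -!big_split; apply: eq_bigr => x _; rewrite -!big_split; apply: eq_bigr => y _.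
  by rewrite /wt !natrD phi_tfreq !mulrDl.
have h1 := hT 1%N 0%N 0%N; have h2 := hT 0%N 1%N 0%N; have h3 := hT 0%N 0%N 1%N.
have h4 := hT 1%N 1%N 0%N; have h5 := hT 1%N 0%N 1%N; have h6 := hT 0%N 1%N 1%N.
do 5 (apply: le_trans (cmod_add _ _) _; rewrite -lerBrDr).
lra.
Qed.

Lemma wt_le6 b n x y : (wt b n x y <= 6)%N.
Proof.
rewrite /wt; case: b; first by case: (tri_cond n 1 1 1 x y).
by case: (tri_cond n 1 0 0 x y); case: (tri_cond n 0 1 0 x y); case: (tri_cond n 0 0 1 x y);
  case: (tri_cond n 1 1 0 x y); case: (tri_cond n 1 0 1 x y); case: (tri_cond n 0 1 1 x y).
Qed.


Lemma act_tfreq_bound j x y n : (x + y <= n)%N -> let k := act j (tfreq x y) in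
  [/\ - (2 * n)%N%:Z <= k.1.1 - k.2 <= (2 * n)%N%:Z,
      - (2 * n)%N%:Z <= k.1.2 - k.2 <= (2 * n)%N%:Z
    & - (2 * n)%N%:Z <= (k.1.1 - k.2) - (k.1.2 - k.2) <= (2 * n)%N%:Z].
Proof. by move=> hp; case: j => [|[|[|[|[|j]]]]] /=; split; lia. Qed.

Lemma act_tfreq_inj j x y x' y' :
  let k := act j (tfreq x y) in let k' := act j (tfreq x' y') in
  k.1.1 - k.2 = k'.1.1 - k'.2 -> k.1.2 - k.2 = k'.1.2 - k'.2 -> x = x' /\ y = y'.
Proof. by case: j => [|[|[|[|[|j]]]]] /= h1 h2; split; lia. Qed.

(** As the node varies, the phases of t - h j/n are those of t minus m/(3n) for
    a pair of integers m which determines the node. *)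
Lemma kernel_majorant_sum n (j : nat) (t : R * R * R) : (0 < n)%N ->
  \sum_(p : 'I_n.+1 * 'I_n.+1 | (p.1 + p.2 <= n)%N) kernel_majorant n (t - act j (tnode R n p.1 p.2))
  <= 2 * (6 * n.+1%:R * harm R (3 * n)) ^+ 2.
Proof.
move=> n0.
have n0' : n%:R != 0 :> R by rewrite pnatr_eq0 -lt0n.
pose m1 (p : 'I_n.+1 * 'I_n.+1) := let k := act j (tfreq p.1 p.2) in k.1.1 - k.2.
pose m2 (p : 'I_n.+1 * 'I_n.+1) := let k := act j (tfreq p.1 p.2) in k.1.2 - k.2.
(* The integers m lie in [-2n, 2n]; adding 3n makes them indices below 6n, that
   is two periods, and shifts the phase by the full turn added to [al]. *)
pose F (al : R) (p : nat) := damp n.+1 (chord (al + 1 - p%:R / (3 * n)%:R)).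
have F0 al p : 0 <= F al p by apply/ltW/damp_gt0 => //; exact: chord_ge0.
have hF al : \sum_(p < 6 * n) F al p <= 6 * n.+1%:R * harm R (3 * n).
  have e : (6 * n = 3 * n + 3 * n)%N by lia.
  rewrite e big_split_ord /=.
  have h := sum_damp_chord (al + 1) n0.
  have h2 : \sum_(i < 3 * n) F al (3 * n + i)%N = \sum_(i < 3 * n) F al i.
    apply: eq_bigr => i _; rewrite /F -(chord_int (al + 1 - i%:R / (3 * n)%:R) (-1)) rmorphN1 natrD.
    by congr (damp _ (chord _)); rewrite natrM; field.
  rewrite h2; rewrite -/(F al) in h *; move: h; rewrite /F; lra.
pose nat_of (m : int) : nat := absz (m + (3 * n)%N%:Z).
have hsh (al : R) (m : int) : - (3 * n)%N%:Z <= m -> damp n.+1 (chord (al - m%:~R / (3 * n)%:R)) = F al (nat_of m).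
  move=> hm; rewrite /F; congr (damp _ (chord _)).
  have -> : (nat_of m)%:R = m%:~R + (3 * n)%:R :> R.
    have e : (nat_of m)%:Z = m + (3 * n)%N%:Z by rewrite /nat_of; lia.
    by rewrite -[LHS]/((nat_of m)%:Z%:~R) e rmorphD.
  by rewrite natrM; field.
have hth1 (p : 'I_n.+1 * 'I_n.+1) : phase1 (t - act j (tnode R n p.1 p.2)) = phase1 t - (m1 p)%:~R / (3 * n)%:R.
  rewrite /tnode act_node /m1 /phase1 /node; case: (act j _) => -[a b] c /=.
  by rewrite rmorphB natrM /=; field.
have hth2 (p : 'I_n.+1 * 'I_n.+1) : phase2 (t - act j (tnode R n p.1 p.2)) = phase2 t - (m2 p)%:~R / (3 * n)%:R.
  rewrite /tnode act_node /m2 /phase2 /node; case: (act j _) => -[a b] c /=.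
  by rewrite rmorphB natrM /=; field.
have bnd (p : 'I_n.+1 * 'I_n.+1) : (p.1 + p.2 <= n)%N -> [/\ - (2 * n)%N%:Z <= m1 p <= (2 * n)%N%:Z,
   - (2 * n)%N%:Z <= m2 p <= (2 * n)%N%:Z & - (2 * n)%N%:Z <= m1 p - m2 p <= (2 * n)%N%:Z].
  exact: act_tfreq_bound.
have inj p q : m1 p = m1 q -> m2 p = m2 q -> p = q.
  move=> h1 h2; have [e1 e2] := act_tfreq_inj h1 h2.
  by case: p q e1 e2 {h1 h2} => [p1 p2] [q1 q2] /= /val_inj -> /val_inj ->.
clearbody m1 m2.
rewrite (eq_bigr (fun p => F (phase1 t) (nat_of (m1 p)) * F (phase2 t) (nat_of (m2 p)) +
   F (phase1 t - phase2 t) (nat_of (m1 p - m2 p)) * F (phase2 t) (nat_of (m2 p)))); last first.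
  move=> p hp; have [b1 b2 b3] := bnd p hp.
  rewrite /kernel_majorant hth1 hth2 -!hsh; [|lia..].
  rewrite mulrC mulrDl; congr (_ + _ * _); congr (damp _ (chord _)).
  rewrite rmorphB /= mulrBl; move: (_ / (3 * n)%:R) => A; move: (_ / (3 * n)%:R) => D; ring.
have sq0 al : 0 <= \sum_(p < 6 * n) F al p by apply: sumr_ge0.
have fin al be : (\sum_(p < 6 * n) F al p) * (\sum_(p < 6 * n) F be p)
    <= (6 * n.+1%:R * harm R (3 * n)) ^+ 2.
  by rewrite expr2; apply: ler_pM.
rewrite big_split /= mulr_natl mulr2n; apply: lerD; apply: le_trans (fin _ _).
  apply: sum_mul_inj_le => //.
  - by move=> p hp; have [b1 b2 b3] := bnd p hp; rewrite /nat_of; lia.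
  - by move=> p hp; have [b1 b2 b3] := bnd p hp; rewrite /nat_of; lia.
  - move=> p q hp hq; have [b1 b2 b3] := bnd p hp; have [c1 c2 c3] := bnd q hq.
    by rewrite /nat_of => h1 h2; apply: inj; lia.
apply: sum_mul_inj_le => //.
- by move=> p hp; have [b1 b2 b3] := bnd p hp; rewrite /nat_of; lia.
- by move=> p hp; have [b1 b2 b3] := bnd p hp; rewrite /nat_of; lia.
- move=> p q hp hq; have [b1 b2 b3] := bnd p hp; have [c1 c2 c3] := bnd q hq.
  by rewrite /nat_of => h1 h2; apply: inj; lia.
Qed.
End Kernel.

(** * The Lebesgue constants *)

Section Lebesgue.
Variable R : realType.
Local Notation C := R[i].

Lemma lagrange_basis_kernel b n x y (t : R * R * R) : lagrange_basis b n x y t =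
  (wt b n x y)%:R / (3 * n ^ 2)%:R * (36^-1 * \sum_(i < 6) \sum_(j < 6)
    sgn R b i * sgn R b j * tri_kernel b n (act i t - act j (tnode R n x y))).
Proof.
rewrite /lagrange_basis; congr (_ * _).
under eq_bigr => u _ do under eq_bigr => v _ do rewrite wave_two_point mulrCA mulr_sumr.
under eq_bigr => u _ do rewrite -mulr_sumr exchange_big /=.
rewrite -mulr_sumr exchange_big /=; congr (_ * _); apply: eq_bigr => i _.
under eq_bigr => u _ do under eq_bigr => v _ do rewrite mulr_sumr.
under eq_bigr => u _ do rewrite exchange_big /=.
rewrite exchange_big /=; apply: eq_bigr => j _.
rewrite /tri_kernel mulr_sumr; apply: eq_bigr => u _; rewrite mulr_sumr.
by apply: eq_bigr => v _; rewrite mulrCA.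
Qed.

(** The weights are at most 6, whence 6/(3n^2) = 2/n^2. *)
Lemma cmod_lagrange_basis b n x y (t : R * R * R) : (0 < n)%N ->
  cmod (lagrange_basis b n x y t) <= if (x + y <= n)%N then
   2 / n%:R ^+ 2 * \sum_(i < 6) \sum_(j < 6) kernel_majorant n (act i t - act j (tnode R n x y))
  else 0.
Proof.
move=> n0; case: leqP => h; last first.
  have z : wt b n x y = 0%N by apply/eqP/contraT => /wt_le; lia.
  by rewrite /lagrange_basis z !mul0r cmod0.
have np : 0 < n%:R :> R by rewrite ltr0n.
rewrite lagrange_basis_kernel !cmodM !cmodV !cmod_nat.
set Sg := \sum_(i < 6) _; set T := \sum_(i < 6) _.
have hS : cmod Sg <= 36 * T.
  rewrite /Sg /T mulr_sumr; apply: le_trans (cmod_sum _ _ _) _; apply: ler_sum => i _.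
  rewrite mulr_sumr; apply: le_trans (cmod_sum _ _ _) _; apply: ler_sum => j _.
  by rewrite !cmodM !cmod_sgn !mul1r tri_kernel_bound.
have hW : (wt b n x y)%:R <= 6 :> R by rewrite ler_nat wt_le6.
have -> : 2 / n%:R ^+ 2 * T = 6 / (3 * n ^ 2)%:R * (36^-1 * (36 * T)).
  by rewrite natrM natrX; field; rewrite gt_eqF.
have p0 : 0 < (3 * n ^ 2)%:R :> R by rewrite ltr0n muln_gt0 expn_gt0 n0.
apply: ler_pM.
- by rewrite divr_ge0 // ltW.
- by rewrite mulr_ge0 ?cmod_ge0 // invr_ge0.
- by rewrite ler_pM2r // invr_gt0.
- by rewrite ler_pM2l // invr_gt0.
Qed.

Definition lebesgue_fun b n (t : R * R * R) : R :=
  \sum_(x < n.+1) \sum_(y < n.+1) cmod (lagrange_basis b n x y t).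

(** The 36 pairs of symmetries contribute 2 (6 (n+1) H)^2 each, with H the
    harmonic sum; (n+1)/n <= 2 then gives 2 * 36 * 2 * 36 * 4 = 144^2. *)
Lemma lebesgue_fun_harm b n t : (0 < n)%N -> lebesgue_fun b n t <= (144 * harm R (3 * n)) ^+ 2.
Proof.
move=> n0; have np : 0 < n%:R :> R by rewrite ltr0n.
rewrite /lebesgue_fun pair_bigA /=.
apply: (@le_trans _ _ (\sum_(p : 'I_n.+1 * 'I_n.+1 | (p.1 + p.2 <= n)%N)
   2 / n%:R ^+ 2 * \sum_(i < 6) \sum_(j < 6) kernel_majorant n (act i t - act j (tnode R n p.1 p.2)))).
  by rewrite [leRHS]big_mkcond; apply: ler_sum => p _; apply: cmod_lagrange_basis.
rewrite -mulr_sumr exchange_big /=.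
apply: (@le_trans _ _ (2 / n%:R ^+ 2 * \sum_(i < 6) \sum_(j < 6) 2 * (6 * n.+1%:R * harm R (3 * n)) ^+ 2)).
  apply: ler_wpM2l; first by rewrite divr_ge0 // sqr_ge0.
  apply: ler_sum => i _; rewrite exchange_big /=; apply: ler_sum => j _.
  exact: kernel_majorant_sum.
rewrite sumr_const card_ord sumr_const card_ord -(mulr_natl (2 * _) 6) -(mulr_natl (6%:R * _) 6).
have h : n.+1%:R <= 2 * n%:R :> R by rewrite -natrM ler_nat; lia.
have -> : 2 / n%:R ^+ 2 * (6%:R * (6%:R * (2 * (6 * n.+1%:R * harm R (3 * n)) ^+ 2)))
  = (72 * harm R (3 * n) * (n.+1%:R / n%:R)) ^+ 2.
  by field; rewrite gt_eqF.
have hp : 0 <= harm R (3 * n) by apply: sumr_ge0 => i _; rewrite invr_ge0.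
have h0 : 0 <= n.+1%:R / n%:R :> R by rewrite divr_ge0.
have h2 : n.+1%:R / n%:R <= 2 :> R by rewrite ler_pdivrMr.
have h3 : 0 <= 72 * harm R (3 * n) by rewrite mulr_ge0.
have -> : 144 * harm R (3 * n) = 72 * harm R (3 * n) * 2 by lra.
by rewrite lerXn2r ?nnegrE ?(mulr_ge0 h3) // ler_wpM2l.
Qed.

(** For n >= 2, 1 + log(3n) is at most log n times the factor
    1 + (1 + log 3) / log 2. *)
Definition lebesgue_const : R := (144 * (1 + (1 + ln 3) / ln 2)) ^+ 2.

Lemma lebesgue_const_ge0 : 0 <= lebesgue_const.
Proof. exact: sqr_ge0. Qed.

Lemma lebesgue_fun_log b n t : (2 <= n)%N -> lebesgue_fun b n t <= lebesgue_const * ln n%:R ^+ 2.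
Proof.
move=> n2; have n0 : (0 < n)%N by lia.
apply: le_trans (lebesgue_fun_harm _ _ n0) _; rewrite /lebesgue_const -exprMn.
have hM : (0 < 3 * n)%N by rewrite muln_gt0.
have l2 : 0 < ln 2 :> R by rewrite ln_gt0 // ltr1n.
have l3 : 0 < ln 3 :> R by rewrite ln_gt0 // ltr1n.
have ln2 : ln 2 <= ln n%:R :> R by rewrite ler_ln ?posrE ?ltr0n // ler_nat.
have h : harm R (3 * n) <= (1 + (1 + ln 3) / ln 2) * ln n%:R.
  apply: le_trans (harm_le _ hM) _.
  rewrite natrM lnM ?posrE ?ltr0n // mulrDl mul1r.
  suff : 1 + ln 3 <= (1 + ln 3) / ln 2 * ln n%:R :> R.
    by move: (_ / _ * _) => Q hQ; lra.
  by rewrite -mulrA ler_peMr // ?ler_pdivlMl ?mulr1 //; lra.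
have h0 : 0 <= harm R (3 * n) by apply: sumr_ge0 => i _; rewrite invr_ge0.
have h1 : 0 <= 144 * harm R (3 * n) by rewrite mulr_ge0.
have h2 : 144 * harm R (3 * n) <= 144 * (1 + (1 + ln 3) / ln 2) * ln n%:R.
  by rewrite -[leRHS]mulrA ler_wpM2l.
by rewrite lerXn2r ?nnegrE // (le_trans h1).
Qed.

Lemma node_Delta n x y : (0 < n)%N -> (x + y <= n)%N -> Delta (tnode R n x y).
Proof.
move=> n0 h; have np : 0 < n%:R :> R by rewrite ltr0n.
have hx : 0 <= x%:R :> R by [].
have hy : 0 <= y%:R :> R by [].
have hn : x%:R + y%:R <= n%:R :> R by rewrite -natrD ler_nat.
rewrite /Delta /inR3H /tnode /node /tfreq /= rmorphN rmorphD /= -[x%:~R]/(x%:R) -[y%:~R]/(y%:R).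
split; first by field; rewrite gt_eqF.
rewrite -[- (_ / _)]mulNr opprK.
by split; apply/andP; split; rewrite ?divr_ge0 ?addr_ge0 ?(ltW np) // ler_pdivrMr // mul1r; lra.
Qed.

Lemma lagrange_bound b n (f : R * R * R -> C) t (A : R) : (2 <= n)%N -> 0 <= A ->
  (forall s, Delta s -> cmod (f s) <= A) -> cmod (lagrange b n f t) <= A * (lebesgue_const * ln n%:R ^+ 2).
Proof.
move=> n2 A0 hf; have n0 : (0 < n)%N by lia.
apply: (@le_trans _ _ (A * lebesgue_fun b n t)); last by rewrite ler_wpM2l // lebesgue_fun_log.
rewrite /lagrange /lebesgue_fun mulr_sumr; apply: le_trans (cmod_sum _ _ _) _; apply: ler_sum => x _.
rewrite mulr_sumr; apply: le_trans (cmod_sum _ _ _) _; apply: ler_sum => y _.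
case: (leqP (x + y) n) => h; last first.
  have z : wt b n x y = 0%N by apply/eqP/contraT => /wt_le; lia.
  by rewrite /lagrange_basis z !mul0r !mulr0 cmod0 mulr0.
by rewrite cmodM ler_wpM2r ?cmod_ge0 // hf //; apply: node_Delta.
Qed.

Lemma opnorm_interp b n : (2 <= n)%N ->
  (opnorm (interp (R:=R) b n) <= (lebesgue_const * ln n%:R ^+ 2)%:E)%E.
Proof.
move=> n2; have n0 : (0 < n)%N by lia.
apply: ub_ereal_sup => _ [f [_ hf] <-]; apply: ub_ereal_sup => _ [t ht <-].
rewrite lee_fin -/(cmod _) interpE // -[leRHS]mul1r.
apply: lagrange_bound => // s hs; rewrite -lee_fin; apply: le_trans hf.
by apply: ereal_sup_ubound; exists s.
Qed.
End Lebesgue.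

(** * Distances in the triangle and the reflection group *)

Section Geometry.
Variable R : realType.
Implicit Types (t s u : R * R * R).

Definition comp_index (i j : nat) : nat := nth 0%N (nth [::]
  [:: [:: 0; 1; 2; 3; 4; 5]; [:: 1; 2; 0; 5; 3; 4]; [:: 2; 0; 1; 4; 5; 3];
      [:: 3; 4; 5; 0; 1; 2]; [:: 4; 5; 3; 2; 0; 1]; [:: 5; 3; 4; 1; 2; 0]] i) j.

Lemma comp_indexP (V : zmodType) (t : V * V * V) (i j : 'I_6) :
  [/\ act i (act j t) = act (comp_index i j) t, (comp_index i j < 6)%N
    & (2 < comp_index i j)%N = (2 < i)%N (+) (2 < j)%N].
Proof.
case: t => -[a b] c.
case: i => -[|[|[|[|[|[|i]]]]]] // hi; case: j => -[|[|[|[|[|[|j]]]]]] // hj;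
  by split; rewrite //= ?opprK.
Qed.

(** In the coordinates e1, e2 the triangle is an alcove of an affine reflection
    group, and a nontrivial element brings a point of the alcove within d of
    another one only if both are near the walls that it crosses.  For each symmetry [k] and each integral
    translation (P, Q) this is a statement of linear arithmetic.  The constant 20
    is not optimal; below 1/20 only translations by -1, 0, 1 occur. *)
Lemma geometry_core (t1 t2 s1 s2 d P Q : R) (k : nat) :
  [/\ 0 <= t1, 0 <= t2 & t1 + t2 <= 1] -> [/\ 0 <= s1, 0 <= s2 & s1 + s2 <= 1] ->
  0 <= d -> d < 1 / 20 ->
  [\/ P = -1, P = 0 | P = 1] -> [\/ Q = -1, Q = 0 | Q = 1] ->
  let w := act k (s1, s2, - (s1 + s2)) in
  let e1 := (t1 + (t1 + t2)) / 3 - (w.1.1 - w.2) / 3 - P in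
  let e2 := (t2 + (t1 + t2)) / 3 - (w.1.2 - w.2) / 3 - Q in
  - d <= e1 <= d -> - d <= e2 <= d ->
  [/\ `|t1 - s1| <= 20 * d, `|t2 - s2| <= 20 * d &
   (2 < k)%N -> [\/ t1 <= 20 * d, t2 <= 20 * d | 1 - (t1 + t2) <= 20 * d] /\
                [\/ s1 <= 20 * d, s2 <= 20 * d | 1 - (s1 + s2) <= 20 * d]].
Proof.
move=> [ht1 ht2 ht3] [hs1 hs2 hs3] d0 d1 hP hQ /=.
have or3 (a b c e : R) : (e < a -> e < b -> e < c -> False) -> [\/ a <= e, b <= e | c <= e].
  move=> h; case: (leP a e) => ha; first by apply: Or31.
  case: (leP b e) => hb; first by apply: Or32.
  by case: (leP c e) => hc; [apply: Or33 | case: (h ha hb hc)].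
case: k => [|[|[|[|[|k]]]]] /= /andP[h1 h2] /andP[h3 h4];
(case: hP => hP; move: h1 h2; rewrite hP => h1 h2;
 case: hQ => hQ; move: h3 h4; rewrite hQ => h3 h4).
(* Most translations are incompatible with d < 1/20. *)
all: try (exfalso; lra).
all: split; [rewrite ler_norml; apply/andP; split; lra
            |rewrite ler_norml; apply/andP; split; lra
            |by [] || (move=> _; split; apply: or3 => ? ? ?; lra)].
Qed.

Lemma near_act (u : R * R * R) (k : nat) (d1 d2 : R) (p q : int) :
  `|phase1 u - p%:~R| <= d1 -> `|phase2 u - q%:~R| <= d2 ->
  exists p' q' : int, `|phase1 (act k u) - p'%:~R| <= d1 + d2 /\
    `|phase2 (act k u) - q'%:~R| <= d1 + d2.
Proof.
case: u => -[a b] c; rewrite /phase1 /phase2 /= !ler_norml => /andP[h1 h2] /andP[h3 h4].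
have [d10 d20] : 0 <= d1 /\ 0 <= d2 by split; lra.
case: k => [|[|[|[|[|k]]]]] /=.
- by exists p, q; rewrite !ler_norml; split; lra.
- by exists (q - p), (- p); rewrite !ler_norml rmorphB rmorphN /=; split; lra.
- by exists (- q), (p - q); rewrite !ler_norml rmorphB rmorphN /=; split; lra.
- by exists (q - p), q; rewrite !ler_norml rmorphB /=; split; lra.
- by exists (- q), (- p); rewrite !ler_norml !rmorphN /=; split; lra.
- by exists p, (p - q); rewrite !ler_norml rmorphB /=; split; lra.
Qed.

Lemma small_int (x d : R) (p : int) : `|x| <= 4 / 3 -> `|x - p%:~R| <= d -> d < 1 / 20 ->
  [\/ p%:~R = -1 :> R, p%:~R = 0 :> R | p%:~R = 1 :> R].
Proof.
rewrite !ler_norml => /andP[h1 h2] /andP[h3 h4] hd.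
have e2 : (2%:Z)%:~R = 2 :> R by [].
have hp : p%:~R < (2%:Z)%:~R :> R by rewrite e2; lra.
have hm : (Negz 1)%:~R < p%:~R :> R by rewrite -[(Negz 1)%:~R]/(- 2%:R : R); lra.
rewrite ltr_int in hp; rewrite ltr_int in hm.
have : [|| p == -1, p == 0 | p == 1] by lia.
by case/or3P => /eqP ->; rewrite ?rmorphN1; [apply: Or31|apply: Or32|apply: Or33].
Qed.

(** The distance of two points of Delta is controlled by the distance of any of
    their images to the periods, as the triangle meets every orbit once.  If the
    two symmetries have opposite parity, a reflection followed by a translation
    almost maps one point to the other, so both are near a wall. *)
Lemma geometry t s (i j : 'I_6) : Delta t -> Delta s ->
  let u := act i t - act j s in let d := chord (phase1 u) + chord (phase2 u) in
  [/\ `|t.1.1 - s.1.1| <= 20 * d, `|t.1.2 - s.1.2| <= 20 * d &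
   (2 < i)%N (+) (2 < j)%N ->
    [\/ t.1.1 <= 20 * d, t.1.2 <= 20 * d | 1 - (t.1.1 + t.1.2) <= 20 * d] /\
    [\/ s.1.1 <= 20 * d, s.1.2 <= 20 * d | 1 - (s.1.1 + s.1.2) <= 20 * d]].
Proof.
move=> ht hs u d.
have [p [hp _]] := chi_near (phase1 u); have [q [hq _]] := chi_near (phase2 u).
have [P [Q [hP hQ]]] := near_act (inv_ord i) hp hq.
have [ecmp kl par] := comp_indexP s (inv_ord i) j.
have eu : act (inv_ord i) u = t - act (comp_index (inv_ord i) j) s by rewrite /u actB actVK ecmp.
rewrite eu -/(chord _) -/(chord _) -/d in hP hQ.
have -> : (2 < i)%N (+) (2 < j)%N = (2 < comp_index (inv_ord i) j)%N.
  by rewrite par; congr (_ (+) _); case: i {u d hp hq hP hQ ecmp kl par eu} => -[|[|[|[|[|[|i]]]]]].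
move: (comp_index _ _) kl hP hQ => k kl {ecmp eu par hp hq}.
have d0 : 0 <= d by rewrite addr_ge0 ?chord_ge0.
move: d d0 => {u} d d0.
case: t ht => -[t1 t2] t3; case: s hs => -[s1 s2] s3.
rewrite /Delta /inR3H /= => -[es [/andP[s11 s12] /andP[s21 s22] /andP[s31 s32]]].
move=> [et [/andP[t11 t12] /andP[t21 t22] /andP[t31 t32]]].
have {es} es : s3 = - (s1 + s2) by lra.
have {et} et : t3 = - (t1 + t2) by lra.
subst s3 t3.
(* For d >= 1/20 the claims are trivial, as the coordinates are at most 1. *)
case: (ltP d (1 / 20)) => hd hP hQ; last first.
  split; rewrite ?ler_norml; try (apply/andP; split; lra).
  by move=> _; split; apply: Or31; lra.
have bnd : `|phase1 ((t1, t2, - (t1 + t2)) - act k (s1, s2, - (s1 + s2)))| <= 4 / 3 /\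
           `|phase2 ((t1, t2, - (t1 + t2)) - act k (s1, s2, - (s1 + s2)))| <= 4 / 3.
  rewrite /phase1 /phase2; case: k {kl hP hQ} => [|[|[|[|[|k]]]]] /=; rewrite !ler_norml;
  by split; apply/andP; split; lra.
have sP := small_int bnd.1 hP hd; have sQ := small_int bnd.2 hQ hd.
apply: (geometry_core _ _ d0 hd sP sQ); try by split; lra.
- by move: hP; rewrite /phase1 ler_norml; case: k {bnd hQ sP sQ kl} => [|[|[|[|[|k]]]]] /= /andP[? ?]; apply/andP; split; lra.
- by move: hQ; rewrite /phase2 ler_norml; case: k {bnd hP sP sQ kl} => [|[|[|[|[|k]]]]] /= /andP[? ?]; apply/andP; split; lra.
Qed.
End Geometry.

(** * Discrete means of a product Fejer kernel *)

Section Jackson.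
Variable R : realType.
Local Notation C := R[i].
Implicit Types (t s u : R * R * R).

Definition hfreq (x y : int) : int * int * int := (x, y, - (x + y)).

Lemma phi_hfreq x y u : phi (hfreq x y) u = chi (x%:~R * phase1 u + y%:~R * phase2 u).
Proof.
rewrite phiE; congr chi; rewrite /dot /phase1 /phase2 /hfreq /= rmorphN rmorphD /=.
by field.
Qed.

Lemma inH_hfreq x y : inH (hfreq x y).
Proof. by rewrite /inH /hfreq /=; lia. Qed.

Lemma hfreqD (x y x' y' : int) : hfreq x y + hfreq x' y' = hfreq (x + x') (y + y').
Proof.
rewrite /hfreq -[LHS]/(x + x', y + y', - (x + y) + - (x' + y')).
by congr (_, _, _); lia.
Qed.

Lemma act0 (V : zmodType) (i : nat) : act i (0 : V * V * V) = 0.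
Proof. by have := actB i (0 : V * V * V) 0; rewrite !subrr. Qed.

Lemma aliases0_opp n (m : int * int * int) : aliases0 n (- m : int * int * int) = aliases0 n m.
Proof.
case: m => -[a b] c.
by apply/aliases0P/aliases0P => -[d [e /= [h1 h2]]]; exists (- d), (- e); split; lia.
Qed.

Lemma diff_lt N (a b : 'I_N) : `|a%:Z - b%:Z| < N%:Z.
Proof. by have := ltn_ord a; have := ltn_ord b; lia. Qed.

Lemma diff_eq0 N (a b : 'I_N) : (a%:Z - b%:Z == 0) = (a == b).
Proof. by rewrite subr_eq0 eqz_nat. Qed.

Lemma sum_diag N : \sum_(p : 'I_N * 'I_N) (p.1 == p.2)%:R = N%:R :> C.
Proof.
rewrite -(pair_bigA _ (fun i j : 'I_N => (i == j)%:R : C)) /=.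
rewrite (eq_bigr (fun=> 1)); first by rewrite sumr_const card_ord.
move=> i _; rewrite (bigD1 i) //= eqxx big1 ?addr0 // => j /negPf.
by rewrite eq_sym => ->.
Qed.

Section Mean.
Variables (n : nat) (t : R * R * R).
Hypothesis n0 : (0 < n)%N.

(** The average of T over the points g t - h j/n, with the quadrature weights.
    It stands for the integral of T over the torus, and equals it for
    trigonometric polynomials of low degree. *)
Definition meanC (T : R * R * R -> C) : C :=
  \sum_(x < n.+1) \sum_(y < n.+1) (wt false n x y)%:R / (3 * n ^ 2)%:R *
    (36^-1 * \sum_(i < 6) \sum_(j < 6) T (act i t - act j (tnode R n x y))).

Definition meanR (T : R * R * R -> R) : R :=
  \sum_(x < n.+1) \sum_(y < n.+1) (wt false n x y)%:R / (3 * n ^ 2)%:R *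
    (36^-1 * \sum_(i < 6) \sum_(j < 6) T (act i t - act j (tnode R n x y))).

Lemma meanRC T : (meanR T)%:C = meanC (fun u => (T u)%:C).
Proof.
rewrite /meanR /meanC rmorph_sum; apply: eq_bigr => x _.
rewrite rmorph_sum; apply: eq_bigr => y _.
rewrite !rmorphM !fmorphV /= !rmorph_nat; congr (_ * (_ * _)).
by rewrite rmorph_sum; apply: eq_bigr => i _; rewrite rmorph_sum.
Qed.

Lemma meanC_phi m : inH m -> meanC (phi m) = if aliases0 n m then wave false m t else 0.
Proof.
move=> hm; have hN : inH (- m : int * int * int).
  by case: m hm => -[a b] c; rewrite /inH /=; lia.
transitivity (wave false m t / (3 * n ^ 2)%:R *
  \sum_(x < n.+1) \sum_(y < n.+1) (wt false n x y)%:R * wave false (- m) (tnode R n x y)).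
  rewrite /meanC mulr_sumr; apply: eq_bigr => x _; rewrite mulr_sumr; apply: eq_bigr => y _.
  have := wave_two_point false m t (tnode R n x y).
  have -> : \sum_(i < 6) \sum_(j < 6) sgn R false i * sgn R false j * phi m (act i t - act j (tnode R n x y))
    = \sum_(i < 6) \sum_(j < 6) phi m (act i t - act j (tnode R n x y)).
    by apply: eq_bigr => i _; apply: eq_bigr => j _; rewrite /sgn /= !mul1r.
  by move=> <-; ring.
rewrite quadrature // aliases0_opp.
case: ifP => _; last by rewrite mulr0.
by rewrite divfK // card_neq0.
Qed.

Lemma meanC_sum (I : finType) (T : I -> R * R * R -> C) :
  meanC (fun u => \sum_i T i u) = \sum_i meanC (T i).
Proof.
rewrite /meanC.
under eq_bigr => x _ do under eq_bigr => y _ do under eq_bigr => i _ do rewrite exchange_big /=.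
under eq_bigr => x _ do under eq_bigr => y _ do rewrite exchange_big /= !mulr_sumr.
under eq_bigr => x _ do rewrite exchange_big /=.
by rewrite exchange_big.
Qed.

Lemma meanR_le T T' : (forall u, T u <= T' u) -> meanR T <= meanR T'.
Proof.
move=> h; apply: ler_sum => x _; apply: ler_sum => y _.
rewrite ler_wpM2l ?divr_ge0 // ler_wpM2l ?invr_ge0 //.
by apply: ler_sum => i _; apply: ler_sum.
Qed.

Lemma meanR_add T T' : meanR (fun u => T u + T' u) = meanR T + meanR T'.
Proof.
rewrite /meanR -big_split; apply: eq_bigr => x _; rewrite -big_split; apply: eq_bigr => y _.
rewrite /= -!mulrDr; congr (_ * (_ * _)).
by rewrite -big_split; apply: eq_bigr => i _; rewrite -big_split.
Qed.

Lemma meanR_scale c T : meanR (fun u => c * T u) = c * meanR T.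
Proof.
rewrite /meanR mulr_sumr; apply: eq_bigr => x _; rewrite mulr_sumr; apply: eq_bigr => y _.
rewrite [RHS]mulrCA; congr (_ * _); rewrite [RHS]mulrCA; congr (_ * _).
by rewrite mulr_sumr; apply: eq_bigr => i _; rewrite mulr_sumr.
Qed.

Variable N : nat.
Hypothesis N0 : (0 < N)%N.
Hypothesis Nn : (2 * N <= n.+1)%N.

Definition dirX u : C := \sum_(a < N) chi (phase1 u) ^+ a.
Definition dirY u : C := \sum_(a < N) chi (phase2 u) ^+ a.
Definition fejX u : R := cmod (dirX u) ^+ 2.
Definition fejY u : R := cmod (dirY u) ^+ 2.
Definition fejer u : R := (N%:R ^+ 2)^-1 * (fejX u * fejY u).

Lemma cmod2_geom (x : R) : ((cmod (\sum_(a < N) chi x ^+ a)) ^+ 2)%:C =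
  \sum_(p : 'I_N * 'I_N) chi ((p.1%:Z - p.2%:Z)%:~R * x) :> C.
Proof.
rewrite cmod_sqr rmorph_sum big_distrlr pair_bigA /=; apply: eq_bigr => p _.
rewrite rmorphXn [X in _ * X ^+ _](_ : _ = chi (- x)); last exact: chi_conj.
rewrite -!chiX -chiD; congr chi.
by rewrite rmorphB /= -[p.1%:~R]/(p.1%:R) -[p.2%:~R]/(p.2%:R); ring.
Qed.

(** |sum_a z^a|^2 is the sum of z^(a - a'); this exhibits the kernels as
    trigonometric polynomials. *)
Lemma fejXE u : (fejX u)%:C = \sum_(p : 'I_N * 'I_N) phi (hfreq (p.1%:Z - p.2%:Z) 0) u.
Proof.
by rewrite /fejX /dirX cmod2_geom; apply: eq_bigr => p _; rewrite phi_hfreq mul0r addr0.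
Qed.

Lemma fejYE u : (fejY u)%:C = \sum_(p : 'I_N * 'I_N) phi (hfreq 0 (p.1%:Z - p.2%:Z)) u.
Proof.
by rewrite /fejY /dirY cmod2_geom; apply: eq_bigr => p _; rewrite phi_hfreq mul0r add0r.
Qed.

Definition diff_freq (r : ('I_N * 'I_N) * ('I_N * 'I_N)) : int * int * int :=
  hfreq (r.1.1%:Z - r.1.2%:Z) (r.2.1%:Z - r.2.2%:Z).

Lemma fejXYE u : (fejX u * fejY u)%:C =
  \sum_(r : ('I_N * 'I_N) * ('I_N * 'I_N)) phi (diff_freq r) u.
Proof.
rewrite rmorphM /= fejXE fejYE big_distrlr pair_bigA /=; apply: eq_bigr => p _.
by rewrite -phiDl hfreqD addr0 add0r.
Qed.

(** Frequencies with both coordinates below N <= (n+1)/2 are too small to alias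
    to 0 unless they vanish. *)
Lemma meanC_hfreq x y : `|x| < N%:Z -> `|y| < N%:Z ->
  meanC (phi (hfreq x y)) = ((x == 0) && (y == 0))%:R.
Proof.
move=> hx hy; rewrite meanC_phi; last exact: inH_hfreq.
have -> : aliases0 n (hfreq x y) = (x == 0) && (y == 0).
  apply/aliases0P/andP => [[d [e []]]|[/eqP-> /eqP->]]; last by exists 0, 0; rewrite /hfreq /=; lia.
  rewrite /hfreq /= => h1 h2.
  have hd : d = 0 by nia.
  have he : e = 0 by nia.
  by rewrite hd he in h1 h2; lia.
case: andP => // -[/eqP -> /eqP ->].
rewrite wave_sum_freq (_ : hfreq 0 0 = 0) //.
have -> : \sum_(i < 6) sgn R false i * phi (act i (0 : int * int * int)) t = 6.
  rewrite (eq_bigr (fun=> 1)); first by rewrite sumr_const card_ord.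
  by move=> i _; rewrite /sgn andFb mul1r act0 phi0.
by rewrite mulVf // pnatr_eq0.
Qed.

Lemma mean_fejX : meanR fejX = N%:R.
Proof.
apply: complexI; rewrite meanRC rmorph_nat.
have -> : (fun u => (fejX u)%:C) = fun u => \sum_(p : 'I_N * 'I_N) phi (hfreq (p.1%:Z - p.2%:Z) 0) u.
  by apply/funext => u; rewrite fejXE.
rewrite meanC_sum -sum_diag; apply: eq_bigr => p _.
by rewrite meanC_hfreq ?diff_lt ?normr0 ?ltz_nat // eqxx andbT diff_eq0.
Qed.

Lemma mean_fejY : meanR fejY = N%:R.
Proof.
apply: complexI; rewrite meanRC rmorph_nat.
have -> : (fun u => (fejY u)%:C) = fun u => \sum_(p : 'I_N * 'I_N) phi (hfreq 0 (p.1%:Z - p.2%:Z)) u.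
  by apply/funext => u; rewrite fejYE.
rewrite meanC_sum -sum_diag; apply: eq_bigr => p _.
by rewrite meanC_hfreq ?diff_lt ?normr0 ?ltz_nat // eqxx /= diff_eq0.
Qed.

Lemma mean_fejer : meanR fejer = 1.
Proof.
have Np : N%:R != 0 :> R by rewrite pnatr_eq0 -lt0n.
rewrite /fejer meanR_scale.
suff -> : meanR (fun u => fejX u * fejY u) = N%:R ^+ 2 by rewrite mulVf // expf_neq0.
apply: complexI; rewrite meanRC rmorphXn /= rmorph_nat.
have -> : (fun u => (fejX u * fejY u)%:C) =
    fun u => \sum_(r : ('I_N * 'I_N) * ('I_N * 'I_N)) phi (diff_freq r) u.
  by apply/funext => u; rewrite fejXYE.
rewrite meanC_sum expr2 -sum_diag big_distrlr [RHS]pair_bigA; apply: eq_bigr => p _.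
by rewrite meanC_hfreq ?diff_lt // !diff_eq0 /= -natrM mulnb.
Qed.

(** Multiplying the geometric sum by 1 - chi x leaves 1 - chi x ^ N.  So one
    Fejer factor times the squared chord is bounded, and the second moment of the
    product kernel reduces to the mean of the other factor. *)
Lemma dirichlet_chord (x : R) :
  cmod (\sum_(a < N) chi x ^+ a) ^+ 2 * chord x ^+ 2 <= 4.
Proof.
rewrite /chord -exprMn -cmodM mulrC -[1 - _]opprB mulNr -subrX1 opprB.
have h : cmod (1 - chi x ^+ N) <= 2.
  by apply: le_trans (cmod_sub _ _) _; rewrite cmod1 cmodX cmod_chi expr1n.
have -> : 4 = 2 ^+ 2 :> R by rewrite expr2; lra.
by rewrite lerXn2r ?nnegrE ?cmod_ge0.
Qed.

Lemma fejer_ge0 u : 0 <= fejer u.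
Proof.
rewrite /fejer; apply: mulr_ge0; first by rewrite invr_ge0 sqr_ge0.
by apply: mulr_ge0; exact: sqr_ge0.
Qed.

(** The first moment is estimated by the second one through
    c <= (1/q + q c^2)/2; the choice q^2 = N balances the two terms. *)
Lemma fejer_moment : meanR (fun u => fejer u * (chord (phase1 u) + chord (phase2 u))) <= 5 / Num.sqrt N%:R.
Proof.
set q := Num.sqrt N%:R.
have Np : 0 < N%:R :> R by rewrite ltr0n.
have q0 : 0 < q by rewrite sqrtr_gt0.
have qq : q ^+ 2 = N%:R by rewrite sqr_sqrtr // ltW.
apply: (@le_trans _ _ (meanR (fun u => q^-1 * fejer u + 2 * q / N%:R ^+ 2 * (fejX u + fejY u)))).
  apply: meanR_le => u; rewrite /fejer.
  have hX : fejX u * chord (phase1 u) ^+ 2 <= 4 by exact: dirichlet_chord.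
  have hY : fejY u * chord (phase2 u) ^+ 2 <= 4 by exact: dirichlet_chord.
  have X0 : 0 <= fejX u by exact: sqr_ge0.
  have Y0 : 0 <= fejY u by exact: sqr_ge0.
  move: (fejX u) (fejY u) (chord (phase1 u)) (chord (phase2 u)) hX hY X0 Y0 => X Y a b hX hY X0 Y0.
  have amgm (c : R) : c <= (q^-1 + q * c ^+ 2) / 2.
    have : 0 <= q^-1 * (1 - q * c) ^+ 2 by rewrite mulr_ge0 ?sqr_ge0 // invr_ge0 ltW.
    have -> : q^-1 * (1 - q * c) ^+ 2 = q^-1 + q * c ^+ 2 - 2 * c by field; rewrite gt_eqF.
    lra.
  have Ni : 0 < (N%:R ^+ 2)^-1 :> R by rewrite invr_gt0 exprn_gt0.
  have step : X * Y * (a + b) <= q^-1 * (X * Y) + 2 * q * (X + Y).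
    have h1 : X * Y * (a + b) <= X * Y * ((q^-1 + q * a ^+ 2) / 2 + (q^-1 + q * b ^+ 2) / 2).
      by rewrite ler_wpM2l ?mulr_ge0 // lerD.
    apply: le_trans h1 _.
    have h2 : q * (Y * (X * a ^+ 2)) <= q * (Y * 4) by rewrite ler_wpM2l ?(ltW q0) // ler_wpM2l.
    have h3 : q * (X * (Y * b ^+ 2)) <= q * (X * 4) by rewrite ler_wpM2l ?(ltW q0) // ler_wpM2l.
    move: (q^-1) => qi; nra.
  have -> : (N%:R ^+ 2)^-1 * (X * Y) * (a + b) = (N%:R ^+ 2)^-1 * (X * Y * (a + b)) by ring.
  have -> : q^-1 * ((N%:R ^+ 2)^-1 * (X * Y)) + 2 * q / N%:R ^+ 2 * (X + Y) =
    (N%:R ^+ 2)^-1 * (q^-1 * (X * Y) + 2 * q * (X + Y)) by ring.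
  by rewrite ler_pM2l.
rewrite meanR_add (meanR_scale q^-1 fejer) (meanR_scale (2 * q / N%:R ^+ 2) (fun u => fejX u + fejY u)) meanR_add mean_fejer mean_fejX mean_fejY.
rewrite le_eqVlt; apply/orP; left; apply/eqP.
rewrite -qq; field; rewrite gt_eqF //.
Qed.
End Mean.
End Jackson.

(** * A quasi-interpolant in the space *)

Section Quasi.
Variable R : realType.
Local Notation C := R[i].
Local Notation fn := (R * R * R -> C).
Implicit Types (t s u : R * R * R).

(** A sine wave whose frequency lies on a wall is identically zero. *)
Lemma wave_fixed k (i : 'I_6) t : (2 < i)%N -> act i k = k -> wave true k t = 0.
Proof.
move=> i2 e; have := wave_act_freq true k t i; rewrite e /sgn i2 /= mulN1r => /eqP.
by rewrite -addr_eq0 -mulr2n -mulr_natl mulf_eq0 pnatr_eq0 /= => /eqP.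
Qed.

(** The chamber of the frequency is read off from the signs of its
    coordinates. *)
Lemma dominant (m : int * int * int) (h : nat) : inH m ->
  `|m.1.1| <= h%:Z -> `|m.1.2| <= h%:Z -> `|m.2| <= h%:Z ->
  exists (i : 'I_6) (x y : nat), act i m = tfreq x y /\ (x + y <= h)%N.
Proof.
case: m => -[a b] c; rewrite /inH /= => e ha hb hc.
have tri_eq (p q r : int) : 0 <= p -> 0 <= q -> p + q + r = 0 -> (p, q, r) = tfreq `|p|%N `|q|%N.
  by move=> p0 q0 pqr; rewrite /tfreq; congr (_, _, _); lia.
case: (leP 0 a) => a0; case: (leP 0 b) => b0; case: (leP 0 c) => c0.
- exists (@Ordinal 6 0 isT), `|a|%N, `|b|%N; split; [by rewrite /= tri_eq|lia].
- exists (@Ordinal 6 0 isT), `|a|%N, `|b|%N; split; [by rewrite /= tri_eq|lia].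
- exists (@Ordinal 6 2 isT), `|c|%N, `|a|%N; split; [rewrite /= tri_eq //; lia|lia].
- exists (@Ordinal 6 5 isT), `|- c|%N, `|- b|%N; split; [rewrite /= tri_eq //; lia|lia].
- exists (@Ordinal 6 1 isT), `|b|%N, `|c|%N; split; [rewrite /= tri_eq //; lia|lia].
- exists (@Ordinal 6 3 isT), `|- a|%N, `|- c|%N; split; [rewrite /= tri_eq //; lia|lia].
- exists (@Ordinal 6 4 isT), `|- b|%N, `|- a|%N; split; [rewrite /= tri_eq //; lia|lia].
- exists (@Ordinal 6 4 isT), `|- b|%N, `|- a|%N; split; [rewrite /= tri_eq //; lia|lia].
Qed.

Lemma wt_neq0 (b : bool) n x y : (0 < n)%N -> (x + y <= n)%N ->
  (b -> tri_cond n 1 1 1 x y) -> wt b n x y != 0%N.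
Proof.
move=> n0 h; rewrite /wt; case: b => [/(_ isT) -> //|_].
by rewrite /tri_cond; lia.
Qed.

(** A symmetrized exponential with all coordinates below n in absolute value has
    a conjugate frequency in the triangle, and is zero if that conjugate is
    excluded from the sine case. *)
Lemma wave_space (b : bool) n (m : int * int * int) : (0 < n)%N -> inH m ->
  `|m.1.1| < n%:Z -> `|m.1.2| < n%:Z -> `|m.2| < n%:Z ->
  space b n (fun t => wave b m t).
Proof.
move=> n0 hm h1 h2 h3; have [P0 _ PZ] := space_closed R b n.
have [||| i [x [y [e hxy]]]] := @dominant m n.-1 hm; [lia..|].
have -> : (fun t => wave b m t) = fun t => sgn R b i * wave b (tfreq x y) t.
  by apply/funext => t; rewrite -e wave_act_freq mulrA sgn_sq mul1r.
apply: (PZ).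
have [hb|] := boolP (b ==> tri_cond n 1 1 1 x y).
  by apply: space_gen => //; apply: wt_neq0 => //; [lia | move=> b1; rewrite b1 in hb].
case: b PZ P0 => //= PZ P0 hb.
have : (x == 0)%N || (y == 0)%N by move: hb; rewrite /tri_cond; lia.
move=> hxy0; suff e0 : (fun t => wave true (tfreq x y) t) = fun=> 0 by move: P0; rewrite -e0.
apply/funext => t; case/orP: hxy0 => /eqP z.
  by apply: (@wave_fixed _ (@Ordinal 6 3 isT)) => //; rewrite /tfreq z /=; congr (_, _, _); lia.
by apply: (@wave_fixed _ (@Ordinal 6 5 isT)) => //; rewrite /tfreq z /=; congr (_, _, _); lia.
Qed.

Variables (n N : nat).
Hypothesis n0 : (0 < n)%N.
Hypothesis N0 : (0 < N)%N.
Hypothesis Nn : (2 * N <= n.+1)%N.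

(** The Fejer kernel symmetrized in both variables, so that it is a combination
    of the waves of the space in [t] and of their conjugates in [s]. *)
Definition quasi_kernel b t s : C := 36^-1 * \sum_(i < 6) \sum_(j < 6)
  sgn R b i * sgn R b j * (fejer N (act i t - act j s))%:C.

(** The weights are the cosine ones in both cases: this makes the mean of the
    Fejer kernel available, and boundary nodes contribute nothing in the sine
    case. *)
Definition quasi b (f : fn) : fn := fun t =>
  \sum_(x < n.+1) \sum_(y < n.+1) (wt false n x y)%:R / (3 * n ^ 2)%:R *
    (f (tnode R n x y) * quasi_kernel b t (tnode R n x y)).

Lemma quasi_kernelE b t s : quasi_kernel b t s = (N%:R ^+ 2)^-1 *
  \sum_(r : ('I_N * 'I_N) * ('I_N * 'I_N)) wave b (diff_freq r) t * wave b (- diff_freq r) s.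
Proof.
rewrite /quasi_kernel; under [in RHS]eq_bigr => r _ do rewrite wave_two_point.
rewrite -[in RHS]mulr_sumr [in RHS]exchange_big /= [RHS]mulrCA; congr (_ * _).
rewrite [RHS]mulr_sumr; apply: eq_bigr => i _.
rewrite [in RHS]exchange_big /= [RHS]mulr_sumr; apply: eq_bigr => j _.
rewrite -[in RHS]mulr_sumr [RHS]mulrCA; congr (_ * _).
by rewrite /fejer rmorphM /= fejXYE fmorphV rmorphXn rmorph_nat.
Qed.

Lemma quasi_space b f : space b n (quasi b f).
Proof.
have hc := space_closed R b n; have [P0 PD PZ] := hc.
apply: lin_closed_sum => // x; apply: lin_closed_sum => // y.
apply: (PZ); apply: (PZ).
have -> : (fun t => quasi_kernel b t (tnode R n x y)) = fun t => (N%:R ^+ 2)^-1 *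
  \sum_(r : ('I_N * 'I_N) * ('I_N * 'I_N)) wave b (diff_freq r) t * wave b (- diff_freq r) (tnode R n x y).
  by apply/funext => t; exact: quasi_kernelE.
apply: (PZ); apply: lin_closed_sum => // r.
under eq_fun do rewrite mulrC.
have := diff_lt r.1.1 r.1.2; have := diff_lt r.2.1 r.2.2; rewrite /diff_freq.
move: (_ - _) (_ - _) => p q hp hq.
by apply: (PZ); apply: wave_space; rewrite /hfreq /inH //=; lia.
Qed.

Variables (b : bool) (f : fn) (L : R).
Hypothesis L0 : 0 <= L.
Hypothesis fL : forall t s, Delta t -> Delta s ->
  cmod (f t - f s) <= L * (`|t.1.1 - s.1.1| + `|t.1.2 - s.1.2|).
Hypothesis f0 : b -> forall t, Delta t -> ~ Delta_int t -> f t = 0.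

(** Move to the nearest side, where f vanishes. *)
Lemma bdry_small t (d : R) : b -> Delta t -> 0 <= d ->
  [\/ t.1.1 <= d, t.1.2 <= d | 1 - (t.1.1 + t.1.2) <= d] -> cmod (f t) <= L * d.
Proof.
move=> hb ht d0 h; have := ht; case: t ht h => -[t1 t2] t3 ht /= h.
rewrite /Delta /inR3H /= => -[et [/andP[t11 t12] /andP[t21 t22] /andP[t31 t32]]].
have aux (s1 s2 : R) : 0 <= s1 <= 1 -> 0 <= s2 <= 1 -> s1 + s2 <= 1 ->
   ~ [/\ 0 < s1, 0 < s2 & s1 + s2 < 1] -> `|t1 - s1| + `|t2 - s2| <= d ->
   cmod (f (t1, t2, t3)) <= L * d.
  move=> hs1 hs2 hs ns hd.
  have hDs : Delta ((s1, s2, - (s1 + s2)) : R * R * R).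
    by rewrite /Delta /inR3H /=; split; [lra | split => //; rewrite opprK; lra].
  have fs : f (s1, s2, - (s1 + s2)) = 0.
    apply: f0 => //; rewrite /Delta_int /= opprK => -[_ h']; exact: ns.
  have := fL ht hDs; rewrite fs subr0 /= => /le_trans; apply.
  by rewrite ler_wpM2l.
case: h => h.
- apply: (aux 0 t2); try lra; first by case; rewrite ltxx.
  by rewrite subr0 subrr normr0 addr0 ger0_norm.
- apply: (aux t1 0); try lra; first by case=> _; rewrite ltxx.
  by rewrite subr0 subrr normr0 add0r ger0_norm.
- apply: (aux (1 - t2) t2); try lra; first by case=> _ _; rewrite subrK ltxx.
  by rewrite subrr normr0 addr0 ler_norml; lra.
Qed.

(** For an even pair this is the Lipschitz condition; for an odd pair in the
    sine case both values are small because both points are near the boundary.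
    Either way the bound is 2 * 20 times [L] times the chords. *)
Lemma sign_close t s u (i j : 'I_6) : Delta t -> Delta s -> u = act i t - act j s ->
  cmod (sgn R b i * sgn R b j * f s - f t) <= 40 * L * (chord (phase1 u) + chord (phase2 u)).
Proof.
move=> ht hs eu; have [g1 g2 g3] := geometry i j ht hs.
move: g1 g2 g3; rewrite -eu; set d := chord _ + chord _ => g1 g2 g3.
have d0 : 0 <= d by rewrite addr_ge0 ?chord_ge0.
have [/andP[hb odd]|ev] := boolP (b && ((2 < i)%N (+) (2 < j)%N)).
  have -> : sgn R b i * sgn R b j = -1.
    by move: odd; rewrite /sgn hb; case: (2 < i)%N; case: (2 < j)%N => //= _; rewrite ?mulr1 ?mul1r.
  have [c1 c2] := g3 odd.
  have d20 : 0 <= 20 * d by rewrite mulr_ge0.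
  have e1 := bdry_small hb ht d20 c1; have e2 := bdry_small hb hs d20 c2.
  by apply: le_trans (cmod_sub _ _) _; rewrite mulN1r cmodN; lra.
have -> : sgn R b i * sgn R b j = 1.
  move: ev; rewrite /sgn; case: b => /=; last by rewrite mulr1.
  by case: (2 < i)%N; case: (2 < j)%N => //= _; rewrite ?mulrNN ?mulr1.
rewrite mul1r -cmodN opprB; apply: le_trans (fL ht hs) _.
have : L * (`|t.1.1 - s.1.1| + `|t.1.2 - s.1.2|) <= L * (20 * d + 20 * d).
  by rewrite ler_wpM2l // lerD.
lra.
Qed.

(** As the kernel has mean 1, the error is the mean of the kernel times the
    differences estimated in [sign_close], hence a first moment. *)
Lemma quasi_error t : Delta t -> cmod (quasi b f t - f t) <= 200 * L / Num.sqrt N%:R.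
Proof.
move=> ht; have m1 := mean_fejer t n0 N0 Nn.
have -> : f t = (meanR n t (fejer N))%:C * f t by rewrite m1 mul1r.
rewrite meanRC /meanC /quasi mulr_suml -sumrB.
apply: (@le_trans _ _ (meanR n t (fun u => 40 * L * (fejer N u * (chord (phase1 u) + chord (phase2 u)))))); last first.
  rewrite meanR_scale; have := fejer_moment t n0 N0 Nn.
  have : 0 <= 40 * L by rewrite mulr_ge0.
  move=> h /(ler_wpM2l h) h2; apply: le_trans h2 _.
  by rewrite mulrA; move: (_^-1) => q; lra.
apply: le_trans (cmod_sum _ _ _) _; apply: ler_sum => x _.
rewrite mulr_suml -sumrB; apply: le_trans (cmod_sum _ _ _) _; apply: ler_sum => y _.
case: (leqP (x + y) n) => hxy; last first.
  have -> : wt false n x y = 0%N by apply/eqP/contraT => /wt_le; lia.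
  by rewrite !mul0r subrr cmod0.
have hs := node_Delta R n0 hxy.
rewrite -[X in _ - X]mulrA -mulrBr cmodM cmodM cmodV !cmod_nat ler_wpM2l ?divr_ge0 //.
rewrite /quasi_kernel mulrCA -[X in _ - X]mulrA -mulrBr cmodM cmodV cmod_nat ler_wpM2l ?invr_ge0 //.
rewrite mulr_sumr mulr_suml -sumrB; apply: le_trans (cmod_sum _ _ _) _; apply: ler_sum => i _.
rewrite mulr_sumr mulr_suml -sumrB; apply: le_trans (cmod_sum _ _ _) _; apply: ler_sum => j _.
set F := fejer N _.
have -> : f (tnode R n x y) * (sgn R b i * sgn R b j * F%:C) - F%:C * f t =
  F%:C * (sgn R b i * sgn R b j * f (tnode R n x y) - f t) by ring.
have F0 : 0 <= F by exact: fejer_ge0.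
rewrite cmodM cmod_real ger0_norm // mulrCA ler_wpM2l //.
exact: sign_close.
Qed.
End Quasi.

(** * Continuously differentiable functions are Lipschitz *)

Section Lip.
Variable R : realType.
Implicit Types (t s : R * R * R) (g : R * R * R -> R).

(** Delta is the image of the unit square under
    (x, y) |-> (x (1 - y), x y, - x). *)
Lemma Delta_compact : compact (@Delta R).
Proof.
pose h (p : R * R) : R * R * R := (p.1 * (1 - p.2), p.1 * p.2, - p.1).
have -> : @Delta R = h @` (`[0, 1] `*` `[0, 1]).
  apply/seteqP; split => [[[t1 t2] t3]|t [[x y]]].
    rewrite /Delta /inR3H /= => -[e [/andP[a1 a2] /andP[b1 b2] /andP[c1 c2]]].
    have [x0|x0] := eqVneq (t1 + t2) 0.
      exists (0, 0); first by rewrite /= !in_itv /=; split; rewrite lexx ler01.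
      by rewrite /h /=; congr (_, _, _); lra.
    have xp : 0 < t1 + t2 by rewrite lt_def x0 addr_ge0.
    exists (t1 + t2, t2 / (t1 + t2)).
      rewrite /= !in_itv /=; split; apply/andP; split; rewrite ?addr_ge0 ?divr_ge0 ?(ltW xp) //; first lra.
      by rewrite ler_pdivrMr //; lra.
    rewrite /h /=; congr (_, _, _); last lra.
      by field.
    by field.
  rewrite /= !in_itv /= => -[/andP[x0 x1] /andP[y0 y1]] <-.
  rewrite /Delta /inR3H /h /=; split; first by ring.
  by rewrite opprK; split; apply/andP; split; nra.
apply: continuous_compact; last by apply: compact_setX; exact: segment_compact.
apply: continuous_subspaceT => p.
have c1 : (fun q : R * R => q.1) q @[q --> p] --> p.1 by exact: cvg_fst.
have c2 : (fun q : R * R => q.2) q @[q --> p] --> p.2 by exact: cvg_snd.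
have k1 : (fun q : R * R => q.1 * (1 - q.2)) q @[q --> p] --> p.1 * (1 - p.2).
  by apply: cvgM c1 _; apply: cvgB c2; exact: cvg_cst.
have k2 : (fun q : R * R => q.1 * q.2) q @[q --> p] --> p.1 * p.2 by apply: cvgM c1 c2.
have k3 : (fun q : R * R => - q.1) q @[q --> p] --> - p.1 by apply: cvgN c1.
exact: cvg_pair (cvg_pair k1 k2) k3.
Qed.

Lemma Delta_bounded g : {within @Delta R, continuous g} ->
  exists M : R, 0 <= M /\ forall t, Delta t -> `|g t| <= M.
Proof.
move=> /continuous_compact /(_ Delta_compact) /compact_bounded [M [Mr hM]].
exists (`|M| + 1); split; first by rewrite addr_ge0.
move=> t ht; apply: (hM (`|M| + 1)).
  by rewrite (le_lt_trans (ler_norm M)) // ltrDl.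
by exists t.
Qed.

Definition plane_pt (x y : R) : R * R * R := (x, y, - (x + y)).

Lemma Delta_int_plane_pt x y : Delta_int (plane_pt x y) <-> [/\ 0 < x, 0 < y & x + y < 1].
Proof.
rewrite /Delta_int /inR3H /plane_pt /= opprK; split => [[]//|h]; split => //; lra.
Qed.

Lemma mvt_bound (phi' dphi : R -> R) (a b M : R) : a <= b ->
  (forall x, a <= x <= b -> is_derive x 1 phi' (dphi x)) ->
  (forall x, a <= x <= b -> `|dphi x| <= M) ->
  `|phi' b - phi' a| <= M * (b - a).
Proof.
move=> ab hd hM.
have [||c] := @MVT_segment R phi' dphi a b ab.
- by move=> x; rewrite in_itv /= => /andP[x1 x2]; apply: hd; rewrite !ltW.
- apply: derivable_within_continuous => x; rewrite in_itv /= => hx.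
  by have := hd x hx => -[].
rewrite in_itv /= => hc ->.
by rewrite normrM (ger0_norm (_ : 0 <= b - a)) ?subr_ge0 // ler_wpM2r ?subr_ge0 // hM.
Qed.

Lemma derive_line1 g (d x y : R) : is_derive (plane_pt x y) ((1, 0, -1) : R * R * R) g d ->
  is_derive x 1 (fun x => g (plane_pt x y)) d.
Proof.
have e : (fun h : R => h^-1 *: (((fun x => g (plane_pt x y)) \o shift x) (h *: (1 : R)) - g (plane_pt x y)))
  = (fun h : R => h^-1 *: ((g \o shift (plane_pt x y)) (h *: ((1, 0, -1) : R * R * R)) - g (plane_pt x y))).
  apply/funext => h /=; congr (_ *: (g _ - _)); rewrite /plane_pt /shift /=.
  rewrite -[RHS]/(h *: 1 + x, h *: 0 + y, h *: (-1) + - (x + y)).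
  by congr (_, _, _); rewrite /GRing.scale /=; ring.
move=> [h1 h2]; split; first by rewrite /derivable e.
by rewrite -h2 /derive e.
Qed.

Lemma derive_line2 g (d x y : R) : is_derive (plane_pt x y) ((0, 1, -1) : R * R * R) g d ->
  is_derive y 1 (fun y => g (plane_pt x y)) d.
Proof.
have e : (fun h : R => h^-1 *: (((fun y => g (plane_pt x y)) \o shift y) (h *: (1 : R)) - g (plane_pt x y)))
  = (fun h : R => h^-1 *: ((g \o shift (plane_pt x y)) (h *: ((0, 1, -1) : R * R * R)) - g (plane_pt x y))).
  apply/funext => h /=; congr (_ *: (g _ - _)); rewrite /plane_pt /shift /=.
  rewrite -[RHS]/(h *: 0 + x, h *: 1 + y, h *: (-1) + - (x + y)).
  by congr (_, _, _); rewrite /GRing.scale /=; ring.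
move=> [h1 h2]; split; first by rewrite /derivable e.
by rewrite -h2 /derive e.
Qed.

Lemma Delta_int_sub t : Delta_int t -> Delta t.
Proof.
case: t => -[a b] c; rewrite /Delta_int /Delta /inR3H /= => -[e [h1 h2 h3]].
by split => //; split; lra.
Qed.


Lemma within_near g t (eta : R) : {within @Delta R, continuous g} -> Delta t -> 0 < eta ->
  exists de : R, 0 < de /\ forall s, Delta s ->
    `|t.1.1 - s.1.1| < de -> `|t.1.2 - s.1.2| < de -> `|t.2 - s.2| < de ->
    `|g t - g s| < eta.
Proof.
move=> /subspace_continuousP hg ht eta0.
have /cvgrPdist_lt /(_ _ eta0) := hg t ht.
rewrite near_withinE => /nbhs_ballP [de /= de0 hde].
by exists de; split => // s hs h1 h2 h3; apply: hde.
Qed.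

(** Of the two axis-parallel paths joining (x, y) to (x', y'), one stays inside:
    the sums x' + y and x + y' of the corners add up to less than 2, so they are
    not both at least 1.  On each leg the mean value theorem applies, with
    the bounds of the continuous extensions of the partial derivatives. *)
Lemma lip_int g : rC1Delta g -> exists M : R, 0 <= M /\
  forall x y x' y', Delta_int (plane_pt x y) -> Delta_int (plane_pt x' y') ->
    `|g (plane_pt x y) - g (plane_pt x' y')| <= M * (`|x - x'| + `|y - y'|).
Proof.
move=> [_ hd].
have [d1 [c1 D1]] := hd _ (or_introl erefl).
have [d2 [c2 D2]] := hd _ (or_intror erefl).
have [M1 [M10 B1]] := Delta_bounded c1.
have [M2 [M20 B2]] := Delta_bounded c2.
pose M := M1 + M2; exists M; split; first by rewrite addr_ge0.
have L1 x x' y : Delta_int (plane_pt x y) -> Delta_int (plane_pt x' y) ->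
    `|g (plane_pt x y) - g (plane_pt x' y)| <= M * `|x - x'|.
  wlog : x x' / x' <= x => [hw|xx] i1 i2.
    case: (leP x' x) => h; first exact: hw.
    by rewrite distrC [X in _ * X]distrC; apply: hw => //; exact: ltW.
  rewrite [X in _ * X]ger0_norm ?subr_ge0 //.
  have inn z : x' <= z <= x -> Delta_int (plane_pt z y).
    move=> hz; move: i1 i2; rewrite !Delta_int_plane_pt => -[? ? ?] [? ? ?]; split; lra.
  apply: (@mvt_bound (fun x => g (plane_pt x y)) (fun x => d1 (plane_pt x y))) => // z hz.
    by apply: derive_line1; apply: D1; apply: inn.
  by apply: le_trans (B1 _ (Delta_int_sub (inn z hz))) _; rewrite /M lerDl.
have L2 x y y' : Delta_int (plane_pt x y) -> Delta_int (plane_pt x y') ->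
    `|g (plane_pt x y) - g (plane_pt x y')| <= M * `|y - y'|.
  wlog : y y' / y' <= y => [hw|xx] i1 i2.
    case: (leP y' y) => h; first exact: hw.
    by rewrite distrC [X in _ * X]distrC; apply: hw => //; exact: ltW.
  rewrite [X in _ * X]ger0_norm ?subr_ge0 //.
  have inn z : y' <= z <= y -> Delta_int (plane_pt x z).
    move=> hz; move: i1 i2; rewrite !Delta_int_plane_pt => -[? ? ?] [? ? ?]; split; lra.
  apply: (@mvt_bound (fun y => g (plane_pt x y)) (fun y => d2 (plane_pt x y))) => // z hz.
    by apply: derive_line2; apply: D2; apply: inn.
  by apply: le_trans (B2 _ (Delta_int_sub (inn z hz))) _; rewrite /M lerDr.
move=> x y x' y' i1 i2.
have [c|c] := ltP (x' + y) 1.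
  have im : Delta_int (plane_pt x' y).
    by move: i1 i2; rewrite !Delta_int_plane_pt => -[? ? ?] [? ? ?]; split.
  have e1 := L1 _ _ _ i1 im; have e2 := L2 _ _ _ im i2.
  have -> : g (plane_pt x y) - g (plane_pt x' y') = (g (plane_pt x y) - g (plane_pt x' y)) + (g (plane_pt x' y) - g (plane_pt x' y')) by ring.
  by apply: le_trans (ler_normD _ _) _; rewrite mulrDr lerD.
have im : Delta_int (plane_pt x y').
  by move: i1 i2; rewrite !Delta_int_plane_pt => -[? ? ?] [? ? ?]; split => //; lra.
have e1 := L2 _ _ _ i1 im; have e2 := L1 _ _ _ im i2.
have -> : g (plane_pt x y) - g (plane_pt x' y') = (g (plane_pt x y) - g (plane_pt x y')) + (g (plane_pt x y') - g (plane_pt x' y')) by ring.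
by apply: le_trans (ler_normD _ _) _; rewrite addrC mulrDr lerD.
Qed.

(** Contract towards the barycenter (1/3, 1/3). *)
Lemma approx_int g t (eta : R) : {within @Delta R, continuous g} -> Delta t -> 0 < eta ->
  exists x y, [/\ Delta_int (plane_pt x y), `|g t - g (plane_pt x y)| < eta,
    `|x - t.1.1| <= eta & `|y - t.1.2| <= eta].
Proof.
move=> hg ht eta0; have [de [de0 hde]] := within_near hg ht eta0.
case: t ht hde => -[t1 t2] t3 ht; have := ht.
rewrite /Delta /inR3H /= => -[et [/andP[a0 a1] /andP[b0 b1] /andP[c0 c1]]] hde.
pose e := Num.min (1 / 2) (Num.min (de / 2) eta).
have e0 : 0 < e by rewrite /e !lt_min; apply/and3P; split; lra.
have [e1 e2 e3] : [/\ e <= 1 / 2, e <= de / 2 & e <= eta].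
  by rewrite /e !ge_min !lexx ?orbT.
have et' : t1 + t2 <= 1 by lra.
exists ((1 - e) * t1 + e / 3), ((1 - e) * t2 + e / 3).
have hi : Delta_int (plane_pt ((1 - e) * t1 + e / 3) ((1 - e) * t2 + e / 3)).
  by rewrite Delta_int_plane_pt; split; nra.
split => //.
- apply: hde; first exact: Delta_int_sub.
  + by rewrite /plane_pt /= ltr_norml; apply/andP; split; nra.
  + by rewrite /plane_pt /= ltr_norml; apply/andP; split; nra.
  + by rewrite /plane_pt /= ltr_norml; apply/andP; split; nra.
- by rewrite ler_norml; apply/andP; split; nra.
- by rewrite ler_norml; apply/andP; split; nra.
Qed.

(** The interior bound passes to the boundary by continuity. *)
Lemma C1_lip g : rC1Delta g -> exists M : R, 0 <= M /\
  forall t s, Delta t -> Delta s ->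
    `|g t - g s| <= M * (`|t.1.1 - s.1.1| + `|t.1.2 - s.1.2|).
Proof.
move=> hg; have [M [M0 hM]] := lip_int hg; have [gc _] := hg.
exists M; split => // t s ht hs; apply/ler_addgt0Pr => e e0.
pose eta := e / (2 + 4 * M).
have D0 : 0 < 2 + 4 * M by lra.
have eta0 : 0 < eta by rewrite divr_gt0.
have ee : e = eta * (2 + 4 * M) by rewrite divfK // gt_eqF.
have [x [y [i1 g1 x1 y1]]] := approx_int gc ht eta0.
have [x' [y' [i2 g2 x2 y2]]] := approx_int gc hs eta0.
have h := hM _ _ _ _ i1 i2.
have h1 : `|x - x'| <= `|t.1.1 - s.1.1| + 2 * eta.
  have -> : x - x' = (x - t.1.1) + (t.1.1 - s.1.1) - (x' - s.1.1) by ring.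
  have := ler_normB (x - t.1.1 + (t.1.1 - s.1.1)) (x' - s.1.1).
  have := ler_normD (x - t.1.1) (t.1.1 - s.1.1); lra.
have h2 : `|y - y'| <= `|t.1.2 - s.1.2| + 2 * eta.
  have -> : y - y' = (y - t.1.2) + (t.1.2 - s.1.2) - (y' - s.1.2) by ring.
  have := ler_normB (y - t.1.2 + (t.1.2 - s.1.2)) (y' - s.1.2).
  have := ler_normD (y - t.1.2) (t.1.2 - s.1.2); lra.
have h3 : `|g t - g s| <= `|g (plane_pt x y) - g (plane_pt x' y')| + 2 * eta.
  have -> : g t - g s = (g t - g (plane_pt x y)) + (g (plane_pt x y) - g (plane_pt x' y')) - (g s - g (plane_pt x' y')) by ring.
  have := ler_normB (g t - g (plane_pt x y) + (g (plane_pt x y) - g (plane_pt x' y'))) (g s - g (plane_pt x' y')).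
  have := ler_normD (g t - g (plane_pt x y)) (g (plane_pt x y) - g (plane_pt x' y')); lra.
have h4 : M * (`|x - x'| + `|y - y'|) <= M * (`|t.1.1 - s.1.1| + `|t.1.2 - s.1.2| + 4 * eta).
  by rewrite ler_wpM2l //; lra.
by rewrite ee; lra.
Qed.
End Lip.

(** * Convergence *)

Section Final.
Variable R : realType.
Local Notation C := R[i].
Local Notation fn := (R * R * R -> C).

Lemma cmod_ReIm (z : C) : cmod z <= `|complex.Re z| + `|complex.Im z|.
Proof.
rewrite {1}[z]complexE; apply: le_trans (cmod_add _ _) _; rewrite cmodM !cmod_real.
rewrite (_ : cmod 'i%C = 1) ?mul1r //.
by rewrite /cmod normc_def /= expr0n expr1n add0r sqrtr1.
Qed.

Lemma C1Delta_lip (f : fn) : C1Delta f -> exists L : R, 0 <= L /\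
  forall t s, Delta t -> Delta s ->
    cmod (f t - f s) <= L * (`|t.1.1 - s.1.1| + `|t.1.2 - s.1.2|).
Proof.
move=> [h1 h2]; have [M1 [M10 B1]] := C1_lip h1; have [M2 [M20 B2]] := C1_lip h2.
exists (M1 + M2); split; first by rewrite addr_ge0.
move=> t s ht hs; apply: le_trans (cmod_ReIm _) _; rewrite mulrDl; apply: lerD.
  by have := B1 t s ht hs; case: (f t) => a b; case: (f s).
by have := B2 t s ht hs; case: (f t) => a b; case: (f s).
Qed.

Lemma lagrange_sub b n (f g : fn) t : lagrange b n f t - lagrange b n g t = lagrange b n (fun s => f s - g s) t.
Proof.
rewrite /lagrange -sumrB; apply: eq_bigr => x _; rewrite -sumrB; apply: eq_bigr => y _.
by rewrite mulrBl.
Qed.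

(** The interpolation operator fixes the quasi-interpolant, so the error is that of
    the quasi-interpolant plus the interpolant of that error. *)
Lemma interp_error (b : bool) n (f : fn) (L : R) t : (2 <= n)%N -> 0 <= L ->
  (forall t s, Delta t -> Delta s ->
    cmod (f t - f s) <= L * (`|t.1.1 - s.1.1| + `|t.1.2 - s.1.2|)) ->
  (b -> forall t, Delta t -> ~ Delta_int t -> f t = 0) -> Delta t ->
  cmod (f t - interp b n f t) <=
    200 * L / Num.sqrt (n./2)%:R * (1 + @lebesgue_const R * ln n%:R ^+ 2).
Proof.
move=> n2 L0 fL f0 ht; have n0 : (0 < n)%N by lia.
pose N := n./2; have N0 : (0 < N)%N by rewrite /N; lia.
have Nn : (2 * N <= n.+1)%N by rewrite /N; lia.
set E := 200 * L / _.
have hE s : Delta s -> cmod (f s - quasi n N b f s) <= E.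
  by move=> hs; rewrite -cmodN opprB; apply: quasi_error.
have E0 : 0 <= E by apply: le_trans (cmod_ge0 _) (hE t ht).
rewrite interpE //.
have -> : f t - lagrange b n f t =
    (f t - quasi n N b f t) - lagrange b n (fun s => f s - quasi n N b f s) t.
  rewrite -lagrange_sub -(lagrange_repro t n0 (quasi_space n0 N0 Nn b f)); ring.
apply: le_trans (cmod_sub _ _) _; rewrite mulrDr mulr1; apply: lerD; first exact: hE.
exact: lagrange_bound.
Qed.

Lemma le_4half n : (2 <= n)%N -> (n <= 4 * n./2)%N.
Proof. lia. Qed.

(** With x = log n, the exponential exp(x/2) exceeds (x/6)^3, so that
    x^2 exp(- x/2) is O(1/x). *)
Lemma log_rate (K e : R) : 0 <= K -> 0 < e -> exists n0 : nat, forall n, (n0 <= n)%N ->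
  (2 <= n)%N /\ K / Num.sqrt (n./2)%:R * (1 + @lebesgue_const R * ln n%:R ^+ 2) < e.
Proof.
move=> K0 e0; have l2 : 0 < ln 2 :> R by rewrite ln_gt0 // ltr1n.
pose A := (ln 2 ^+ 2)^-1 + @lebesgue_const R.
have A0 : 0 < A by rewrite /A ltr_pwDl ?lebesgue_const_ge0 // invr_gt0 exprn_gt0.
pose Q : R := 6 ^+ 3 * 2.
have Q0 : 0 < Q by rewrite mulr_gt0 // exprn_gt0.
have QKA : 0 <= Q * K * A by apply: mulr_ge0 (ltW A0); apply: mulr_ge0 (ltW Q0) K0.
pose X := Q * K * A / e + 1.
have X0 : 0 < X by rewrite /X ltr_wpDl // divr_ge0 // ltW.
pose n0 := maxn 2 (Num.trunc (expR X)).+1.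
exists n0 => n hn.
have n2 : (2 <= n)%N by lia.
split => //.
have np : 0 < n%:R :> R by rewrite ltr0n; lia.
pose x := ln n%:R : R.
have hx : X < x.
  rewrite -ltr_expR /x lnK ?posrE //.
  have /andP[_ h] := truncn_itv (ltW (expR_gt0 X)).
  apply: lt_le_trans h _; rewrite ler_nat; lia.
have x0 : 0 < x by exact: lt_trans hx.
have hxl : ln 2 <= x by rewrite /x ler_ln ?posrE ?ltr0n ?(ler_nat _ 2) // ltnW.
pose y := expR (x / 6).
have hy : x / 6 <= y by apply: le_trans (expR_ge1Dx _); lra.
have y6 : y ^+ 6 = n%:R.
  by rewrite /y -expRM_natr divfK ?pnatr_eq0 // /x lnK ?posrE.
set q := Num.sqrt _.
have qq : q ^+ 2 = (n./2)%:R by rewrite sqr_sqrtr.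
have nq : n%:R <= 4 * q ^+ 2 by rewrite qq -natrM ler_nat le_4half.
have q0 : 0 <= q by exact: sqrtr_ge0.
have x60 : 0 <= x / 6 by rewrite divr_ge0 // ltW.
have qy : (x / 6) ^+ 3 <= 2 * q.
  apply: (@le_trans _ _ (y ^+ 3)); first by rewrite lerXn2r ?nnegrE // (le_trans x60).
  have y0 : 0 <= y by exact: le_trans hy.
  rewrite -ler_sqr ?nnegrE ?exprn_ge0 ?mulr_ge0 //.
  by rewrite -exprM y6 exprMn (_ : 2 ^+ 2 = 4) // expr2; lra.
have x3 : 0 < x ^+ 3 by rewrite exprn_gt0.
have qQ : x ^+ 3 <= Q * q.
  have -> : x ^+ 3 = 6 ^+ 3 * (x / 6) ^+ 3 by rewrite -exprMn mulrC divfK ?pnatr_eq0.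
  by rewrite /Q -[leRHS]mulrA; apply: ler_wpM2l qy; exact: exprn_ge0.
have qp : 0 < q.
  by rewrite -(pmulr_rgt0 _ Q0); apply: lt_le_trans qQ.
have qi : q^-1 <= Q / x ^+ 3.
  by rewrite ler_pdivlMr // mulrC ler_pdivrMr.
have bA : 1 + @lebesgue_const R * ln n%:R ^+ 2 <= A * x ^+ 2.
  rewrite /A -/x mulrDl lerD2r ler_pdivlMl ?exprn_gt0 // mulr1.
  by rewrite lerXn2r ?nnegrE // ltW.
have b0 : 0 <= 1 + @lebesgue_const R * ln n%:R ^+ 2.
  by apply: addr_ge0 => //; apply: mulr_ge0 (lebesgue_const_ge0 R) (sqr_ge0 _).
apply: (@le_lt_trans _ _ (K * (Q / x ^+ 3) * (A * x ^+ 2))).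
  apply: ler_pM => //; first by apply: mulr_ge0 => //; rewrite invr_ge0.
  by rewrite ler_wpM2l.
have -> : K * (Q / x ^+ 3) * (A * x ^+ 2) = Q * K * A / x.
  by field; rewrite gt_eqF.
rewrite ltr_pdivrMr // -ltr_pdivrMl // mulrC; apply: lt_trans hx.
by rewrite /X ltrDl.
Qed.

Lemma uniform_cvgP (F : nat -> fn) (f : fn) :
  (forall e : R, 0 < e -> exists n0 : nat, forall n, (n0 <= n)%N ->
    forall t, Delta t -> cmod (f t - F n t) < e) ->
  {uniform Delta (R:=R), (fun n => F n : pt R -> R[i]^o) @ \oo --> (f : pt R -> R[i]^o)}.
Proof.
move=> h P /uniform_nbhs [E [entE sE]].
move: entE; rewrite -entourage_from_ballE => -[e /= e0 he].
have [er ee] : exists er : R, e = er%:C.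
  by exists (complex.Re e); rewrite RRe_real // gtr0_real.
have er0 : 0 < er by rewrite ee ltcR in e0.
have [n0 hn0] := h er er0.
exists n0 => // n /= hn; apply: sE => t ht; apply: he => /=.
by rewrite /ball /= ee cmodE ltcR; exact: hn0.
Qed.

Lemma uniform_interp (b : bool) (f : fn) : C1Delta f ->
  (b -> forall t, Delta t -> ~ Delta_int t -> f t = 0) ->
  {uniform Delta (R:=R), (fun n => interp b n f : pt R -> R[i]^o) @ \oo --> (f : pt R -> R[i]^o)}.
Proof.
move=> hf f0; have [L [L0 fL]] := C1Delta_lip hf.
apply: uniform_cvgP => e e0.
have K0 : 0 <= 200 * L by rewrite mulr_ge0.
have [n0 hn0] := log_rate K0 e0.
exists n0 => n /hn0 [n2 hr] t ht.
exact: le_lt_trans (interp_error n2 L0 fL f0 ht) hr.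
Qed.
End Final.

Theorem theorem4p8 (R : realType) :
  (exists c : R, forall n : nat, (2 <= n)%N ->
    (opnorm (@interpTS R n) <= (c * ln n%:R ^+ 2)%:E)%E /\
    (opnorm (@interpTC R n) <= (c * ln n%:R ^+ 2)%:E)%E) /\
  (forall f : pt R -> R[i], C1Delta f ->
    ((forall t, Delta t -> ~ Delta_int t -> f t = 0) ->
      {uniform Delta (R:=R),
        (fun n => interpTS n f : pt R -> R[i]^o) @ \oo --> (f : pt R -> R[i]^o)}) /\
    {uniform Delta (R:=R),
      (fun n => interpTC n f : pt R -> R[i]^o) @ \oo --> (f : pt R -> R[i]^o)}).
Proof.
split=> [|f hf].
  exists (lebesgue_const R) => n n2.
  by split; [exact: (opnorm_interp R true n2)|exact: (opnorm_interp R false n2)].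
split=> [f0|].
  by apply: (@uniform_interp R true f hf) => _.
exact: (@uniform_interp R false f hf).
Qed.
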